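(* There exists an almost disjoint family $\mathcal{F}$ of true cardinality $\mathfrak{c}$ that is mildly-normal but not partly-normal; that is, the space $\Psi(\mathcal{F})$ is mildly-normal and is not partly-normal.
   Context: An almost disjoint family is an infinite family $\mathcal{A}$ of infinite subsets of $\omega$ such that $a\cap b$ is finite for all distinct $a,b\in\mathcal{A}$ (all almost disjoint families are assumed infinite). For $B\subseteq\omega$ let $\mathcal{A}\upharpoonright_B=\{a\in\mathcal{A}: |a\cap B|=\omega\}$. $\mathcal{A}$ is of true cardinality $\mathfrak{c}$ if for every $B\subseteq\omega$, $\mathcal{A}\upharpoonright_B$ is either finite or of size $\mathfrak{c}=2^{\aleph_0}$. The Mrówka–Isbell space $\Psi(\mathcal{A})$ has underlying set $\omega\cup\mathcal{A}$ (disjoint union); each $\{n\}$ with $n\in\omega$ is open, and the basic open neighbourhoods of a point $a\in\mathcal{A}$ are the sets $\{a\}\cup(a\setminus F)$ with $F\subset\omega$ finite. In a topological space $X$, a set $A$ is regular closed if $A=\overline{\operatorname{int}(A)}$, and $\pi$-closed if it is the intersection of finitely many regular closed sets. Two sets $A,B\subseteq X$ are separated if there are disjoint open sets $U\supseteq A$ and $V\supseteq B$. A regular space is mildly-normal if any two disjoint regular closed sets are separated; it is partly-normal if any two disjoint sets, one regular closed and the other $\pi$-closed, are separated. An almost disjoint family $\mathcal{A}$ is said to have one of these properties if $\Psi(\mathcal{A})$ has it. *)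

(* Defs.v *)
From HB Require Import structures.
From mathcomp Require Import all_boot all_classical.
From mathcomp Require Import topology.

Set Implicit Arguments.
Unset Strict Implicit.
Unset Printing Implicit Defensive.

Local Open Scope classical_set_scope.
Local Open Scope card_scope.

Definition almost_disjoint_family (A : set (set nat)) : Prop :=
  [/\ infinite_set A,
      forall a, A a -> infinite_set a &
      forall a b, A a -> A b -> a <> b -> finite_set (a `&` b)].

Definition ad_restr (A : set (set nat)) (B : set nat) : set (set nat) :=
  [set a | A a /\ infinite_set (a `&` B)].

(* The continuum is the cardinality of [set: set nat], the power set of nat. *)
Definition true_cardinality_continuum (A : set (set nat)) : Prop :=
  forall B : set nat,
    finite_set (ad_restr A B) \/ (ad_restr A B #= [set: set nat]).

(* The Mrowka-Isbell space; A is coerced to the type of its elements. A fresh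
   name keeps the topology below off the bare sum type. *)
Definition Psi (A : set (set nat)) : Type := (nat + A)%type.

Section PsiTopology.
Variable A : set (set nat).

HB.instance Definition _ := gen_eqMixin (Psi A).
HB.instance Definition _ := gen_choiceMixin (Psi A).

Definition Psi_nat (n : nat) : Psi A := inl n.
Definition Psi_pt (a : A) : Psi A := inr a.

Definition Psi_basic (x : Psi A) : set_system (Psi A) :=
  match x with
  | inl n => [set [set Psi_nat n]]
  | inr a => [set Psi_pt a |` Psi_nat @` (set_val a `\` F)
               | F in @finite_set nat]
  end.

Definition Psi_nbhs (x : Psi A) : set_system (Psi A) :=
  filter_from (Psi_basic x) id.

HB.instance Definition _ := hasNbhs.Build (Psi A) Psi_nbhs.

Lemma Psi_basic_mem (x : Psi A) (U : set (Psi A)) : Psi_basic x U -> U x.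
Proof. by case: x => [n ->|a [F _ <-]] //=; left. Qed.

Lemma Psi_nbhs_filter (x : Psi A) : ProperFilter (nbhs x).
Proof.
apply: filter_from_proper; last first.
  by move=> U xU; exists x; exact: Psi_basic_mem xU.
apply: filter_from_filter; case: x => [n|a].
- by exists [set Psi_nat n].
- by exists (Psi_pt a |` Psi_nat @` (set_val a `\` set0)); exists set0.
- by move=> U V -> ->; exists [set Psi_nat n].
- move=> U V [F finF <-] [G finG <-].
  exists (Psi_pt a |` Psi_nat @` (set_val a `\` (F `|` G))).
    by exists (F `|` G) => //; rewrite finite_setU.
  move=> y [->|[n [an FGn] <-]]; first by split; left.
  by split; right; exists n => //; split=> // ?; apply: FGn; [left|right].
Qed.

Lemma Psi_nbhs_singleton (x : Psi A) (U : set (Psi A)) : nbhs x U -> U x.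
Proof. by case=> V /Psi_basic_mem xV; exact. Qed.

Lemma Psi_nbhs_nbhs (x : Psi A) (U : set (Psi A)) :
  nbhs x U -> nbhs x (nbhs^~ U).
Proof.
move=> [V xV VU]; exists V => // y Vy.
case: y Vy => [n|b] Vy.
  by exists [set Psi_nat n] => // _ ->; exact: VU.
exists V => //.
case: x xV => [n|a] /= xV; first by move: Vy; rewrite xV.
case: xV Vy => F finF <- [[->]|[]//].
by exists F.
Qed.

HB.instance Definition _ := Nbhs_isNbhsTopological.Build (Psi A)
  Psi_nbhs_filter Psi_nbhs_singleton Psi_nbhs_nbhs.

End PsiTopology.

Section Normality.
Variable X : topologicalType.

Definition piclosed (P : set X) : Prop :=
  exists2 D : set (set X), finite_set D &
    (forall C, D C -> regclosed C) /\ P = \bigcap_(C in D) C.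

(* Not the library's [separated], which only asks that each of the two sets
   miss the closure of the other. *)
Definition open_separated (P Q : set X) : Prop :=
  exists U V : set X,
    [/\ open U, open V, P `<=` U, Q `<=` V & U `&` V = set0].

Definition mildly_normal : Prop :=
  regular_space X /\
  forall P Q : set X, regclosed P -> regclosed Q -> P `&` Q = set0 ->
    open_separated P Q.

Definition partly_normal : Prop :=
  regular_space X /\
  forall P Q : set X, regclosed P -> piclosed Q -> P `&` Q = set0 ->
    open_separated P Q.

End Normality.

(* Main.v *)
(* The core is an almost disjoint family A of true cardinality continuum, all of
   whose elements lie inside one of three disjoint sets W0, W1, W2 and which has
   continuum many elements inside each of them.  Given such an A, call a set big if
   it meets infinitely many (hence continuum many) elements of A in an infinite set,
   choose for each pair (P, Q) of big sets elements a of A meeting P and b of A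
   meeting Q, all of them distinct, and let F consist of the unions of a and b.
   Two disjoint regular closed sets with big traces then share a point, and the
   others are separated because one of the traces meets finitely many elements only;
   no element of F meets all of W0, W1 and W2, but a set X separating cl W0 from the
   intersection of cl W1 and cl W2 contradicts the choice made for one of the pairs
   (W1 /\ X, W2) and (W0, W1 - X).

   The family A is built in continuum many stages along a tree.  Fix a sequence of
   functions, well-ordered and increasing modulo finite, which is unbounded on every
   infinite set.  A node carries a countable family of sets, regarded as columns; its
   children are indexed by the omega-cofinal positions x of the sequence and stand for
   the sets which are, modulo finite, below the function at x but not below any
   earlier one.  Distinct children are almost disjoint, and a set B meeting infinitely
   many columns of a node meets infinitely many columns of at least two of its
   children, hence of all nodes on a perfect set of branches of length omega; as there
   are fewer than continuum many elements so far, some such branch is free and a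
   subset of B can be attached at its end.  Conversely, if B meets infinitely many
   elements already attached, these form a fan or a comb in the tree, and in both
   cases B meets infinitely many columns of the limit node. *)
Require Import Defs.
From mathcomp Require Import all_boot all_classical.
From mathcomp Require Import topology.
From mathcomp Require Import wochoice.

Set Implicit Arguments.
Unset Strict Implicit.
Unset Printing Implicit Defensive.

Local Open Scope classical_set_scope.
Local Open Scope card_scope.

(** * Well-orders and the continuum *)

Definition is_worder (T : Type) (lt : T -> T -> Prop) :=
  [/\ well_founded lt, (forall x y z, lt x y -> lt y z -> lt x z) &
      forall x y, [\/ lt x y, x = y | lt y x]].

Section WellOrder.
Variables (T : Type) (lt : T -> T -> Prop).
Hypothesis wo : is_worder lt.

Lemma wo_trans y x z : lt x y -> lt y z -> lt x z.
Proof. by case: wo => _ + _; apply. Qed.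

Lemma wo_total x y : [\/ lt x y, x = y | lt y x].
Proof. by case: wo. Qed.

Lemma wo_irr x : ~ lt x x.
Proof.
case: wo => wf _ _; elim/(well_founded_ind wf) : x => x IH xx.
exact: (IH _ xx xx).
Qed.

Lemma wo_ltW x y : ~ lt x y -> y = x \/ lt y x.
Proof. by case: (wo_total x y) => // [->|]; [left|right]. Qed.

Lemma wo_leN x y : y = x \/ lt y x -> ~ lt x y.
Proof. by move=> [->|yx xy]; [exact: wo_irr|exact: (wo_irr (wo_trans xy yx))]. Qed.

Lemma wo_le_lt y x z : ~ lt y x -> lt y z -> lt x z.
Proof. by move=> /wo_ltW[->//|xy]; exact: wo_trans. Qed.

Lemma wo_lt_le y x z : lt x y -> ~ lt z y -> lt x z.
Proof. by move=> xy /wo_ltW[<-//|]; exact: wo_trans. Qed.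

Lemma wo_le_trans y x z : ~ lt y x -> ~ lt z y -> ~ lt z x.
Proof. by move=> yx zy zx; exact: yx (wo_le_lt zy zx). Qed.

Lemma wo_least (P : set T) : P !=set0 ->
  exists2 x, P x & forall y, P y -> ~ lt y x.
Proof.
case: wo => wf _ _ [x]; elim/(well_founded_ind wf) : x => x IH Px.
have [[y Py yx]|N] := pselect (exists2 y, P y & lt y x); first exact: IH Py.
by exists x => // y Py yx; apply: N; exists y.
Qed.

Lemma wo_pullback (U : Type) (f : U -> T) : injective f ->
  is_worder (fun x y => lt (f x) (f y)).
Proof.
case: wo => wf tr tot finj; split.
- move=> x; have [t ft] : exists t, t = f x by exists (f x).
  elim/(well_founded_ind wf) : t x ft => t IH x ft; constructor => y yx.
  by apply: (IH (f y)) => //; rewrite ft.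
- by move=> x y z; exact: tr.
- move=> x y; case: (tot (f x) (f y)); [exact: Or31| |exact: Or33].
  by move/finj => ->; exact: Or32.
Qed.

End WellOrder.

(** [well_ordering_principle] gives every nonempty predicate a unique least element. Reflexivity,
    totality and transitivity come from sets of one, two and three points, well-foundedness from the
    set of inaccessible points. *)
Lemma worder_exists (T : Type) : exists lt : T -> T -> Prop, is_worder lt.
Proof.
have [R wR] := well_ordering_principle {classic T}.
have pick (P : T -> Prop) : (exists x, P x) ->
    exists x, [/\ P x, forall y, P y -> R x y &
      forall z, P z -> (forall y, P y -> R z y) -> x = z].
  move=> [x Px]; have [] := wR (fun y => `[< P y >]).
    by exists x; apply/asboolP.
  move=> z [[Pz zmin] zuniq]; exists z; split; first exact/asboolP.
    by move=> y Py; apply: zmin; apply/asboolP.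
  move=> w Pw wmin; apply: zuniq; split; first exact/asboolP.
  by move=> y /asboolP; exact: wmin.
have refl x : R x x.
  by have [|z [-> + _]] := pick (eq^~ x); [exists x|exact].
have tot x y : R x y \/ R y x.
  have [|z [[->|->] zmin _]] := pick (fun z => z = x \/ z = y).
  - by exists x; left.
  - by left; apply: zmin; right.
  - by right; apply: zmin; left.
have anti x y : R x y -> R y x -> x = y.
  move=> xy yx; have [|z [_ _ zu]] := pick (fun z => z = x \/ z = y).
    by exists x; left.
  rewrite -(zu x); [apply: zu| |]; [by right| | by left|]; by move=> w [] ->.
exists (fun x y => R x y /\ x <> y); split.
- move=> x; apply: contrapT => nx.
  have [|z [nz zmin _]] := pick (fun x => ~ Acc (fun x y => R x y /\ x <> y) x).
    by exists x.
  apply: nz; constructor => y [yz ynz]; apply: contrapT => ny.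
  by apply: ynz; apply: anti => //; exact: zmin.
- move=> x y z [xy nxy] [yz nyz]; split; last first.
    by move=> xz; apply: nyz; apply: anti => //; rewrite -xz.
  have [|m [+ mmin _]] := pick (fun m => [\/ m = x, m = y | m = z]).
    by exists x; exact: Or31.
  move=> [mE|mE|mE]; move: mmin; rewrite mE => mmin.
  + by apply: mmin; exact: Or33.
  + by exfalso; apply: nxy; apply: anti => //; apply: mmin; exact: Or31.
  + by exfalso; apply: nyz; apply: anti => //; apply: mmin; exact: Or32.
- move=> x y; have [->|nxy] := pselect (x = y); first exact: Or32.
  by case: (tot x y) => ?; [apply: Or31|apply: Or33]; split => // /esym.
Qed.

Lemma card_le_setTP (T U : Type) (B : set U) : [set: T] #<= B <->
  exists2 f : T -> U, injective f & forall x, B (f x).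
Proof.
split=> [/card_leP/injfunPex[f _ finj]|[f finj fB]].
  exists (fun x => \val (f (exist _ x (in_setT x)))); last first.
    by move=> x; exact: set_valP.
  move=> x y /val_inj /finj fxy; have := fxy _ _; rewrite !in_setT.
  by case/(_ isT isT).
have [g] : $|{injfun [set: T] >-> B}|.
  by apply/injfunPex; exists f => [x _|x y _ _]; [exact: fB|exact: finj].
exact: inj_card_le.
Qed.

Definition continuum_le (T : Type) (A : set T) := [set: set nat] #<= A.

Lemma continuum_leP (T : Type) (A : set T) : continuum_le A <->
  exists2 f : set nat -> T, injective f & forall x, A (f x).
Proof. exact: card_le_setTP. Qed.

Lemma continuum_le_sub (T : Type) (A B : set T) :
  A `<=` B -> continuum_le A -> continuum_le B.
Proof. by move=> AB cA; exact: card_le_trans cA (subset_card_le AB). Qed.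

Lemma continuum_le_image (T U : Type) (f : T -> U) (A : set T) :
  continuum_le (f @` A) -> continuum_le A.
Proof. by move=> c; exact: card_le_trans c (card_image_le f A). Qed.

(** Take the least point with continuum many predecessors, if there is one, and pull the order back
    along an injection into its initial segment. *)
Lemma continuum_worder : exists lt : set nat -> set nat -> Prop,
  is_worder lt /\ forall x, ~ continuum_le [set y | lt y x].
Proof.
have [lt wo] := worder_exists (set nat).
have [N|/existsNP[x0 /contrapT cx0]] :=
  pselect (forall x, ~ continuum_le [set y | lt y x]); first by exists lt.
have [x cx xmin] := wo_least wo
  (ex_intro (fun x => continuum_le [set y | lt y x]) x0 cx0).
have [f finj fx] := (continuum_leP _).1 cx.
exists (fun y z => lt (f y) (f z)); split; first exact: wo_pullback.
move=> y cy; apply: (xmin (f y)); last exact: fx.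
have [g ginj gy] := (continuum_leP _).1 cy.
by apply/continuum_leP; exists (f \o g) => //; exact: inj_comp.
Qed.

(* Koenig's diagonal argument, through the bijection of the continuum with its
   countable power. *)
Lemma continuum_bigcup (T : Type) (S : nat -> set T) :
  continuum_le (\bigcup_n S n) -> exists n, continuum_le (S n).
Proof.
move=> /continuum_leP[f finj fS]; apply: contrapT => N.
pose proj (n : nat) (X : set nat) : set nat := [set m | X (pickle (n, m))].
have miss n : exists Y, forall X, S n (f X) -> proj n X <> Y.
  apply: contrapT => H; apply: N; exists n.
  have /choice[h hP] : forall Y, exists X, S n (f X) /\ proj n X = Y.
    move=> Y; apply: contrapT => HY; apply: H; exists Y => X SX pX.
    by apply: HY; exists X.
  apply/continuum_leP; exists (f \o h); last by move=> Y; exact: (hP Y).1.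
  by move=> Y Z /finj hYZ; rewrite -(hP Y).2 -(hP Z).2 hYZ.
have {miss} /choice[Y YP] := miss.
pose X : set nat := [set p | exists n m, p = pickle (n, m) /\ Y n m].
have [n _ SX] := fS X; apply: (YP n X SX); rewrite predeqE => m; split.
  move=> [n' [m' [/(pcan_inj pickleK)[-> ->]]]]; exact.
by move=> Ym; exists n, m.
Qed.

Lemma continuum_setU (T : Type) (A B : set T) :
  continuum_le (A `|` B) -> continuum_le A \/ continuum_le B.
Proof.
move=> cAB; have [|n] := @continuum_bigcup T (fun n => if n is 0 then A else B).
  apply: continuum_le_sub cAB => x [Ax|Bx]; first by exists 0.
  by exists 1.
by case: n; [left|right].
Qed.

Lemma continuum_infinite (T : Type) (A : set T) :
  continuum_le A -> infinite_set A.
Proof.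
move=> /continuum_leP[f finj fA]; apply/infiniteP/card_le_setTP.
exists (fun n => f [set n]) => [m n /finj|n]; last exact: fA.
by rewrite predeqE => /(_ m) [/(_ erefl)].
Qed.

(** * Unbounded sequences of functions *)

Definition eventually_le (f g : nat -> nat) :=
  exists N, forall k, (N <= k)%N -> (f k <= g k)%N.

Lemma eventually_le_trans g f h :
  eventually_le f g -> eventually_le g h -> eventually_le f h.
Proof.
move=> [N fg] [M gh]; exists (maxn N M) => k; rewrite geq_max => /andP[Nk Mk].
exact: leq_trans (fg k Nk) (gh k Mk).
Qed.

Lemma eventually_le_sup (f : nat -> nat -> nat) :
  exists h, forall n, eventually_le (f n) h.
Proof.
exists (fun k => \max_(n < k.+1) f n k) => n; exists n => k nk.
by rewrite -ltnS in nk; exact: (@leq_bigmax _ (fun i : 'I_k.+1 => f i k) (Ordinal nk)).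
Qed.

Lemma infinite_natP (K : set nat) :
  infinite_set K <-> forall n, exists2 k, K k & (n <= k)%N.
Proof.
split=> [infK n|H finK].
  apply: contrapT => N; apply: infK; apply: sub_finite_set (finite_II n) => k Kk.
  by rewrite /= ltnNge; apply/negP => nk; apply: N; exists k.
have [X KX] := (finite_seqP K).1 finK.
have [k Kk] := H (\max_(i <- X) i).+1.
apply/negP; rewrite -leqNgt.
by rewrite KX /= in Kk; exact: (@leq_bigmax_seq _ X xpredT id k).
Qed.

(** This is an unbounded well-ordered sequence as in the definition of $\mathfrak{b}$. Unboundedness
    is required on every infinite [K] because it is applied to the set of columns that a given set
    meets. *)
Record scale := Scale {
  scale_car :> Type;
  slt : scale_car -> scale_car -> Prop;
  slt_wo : is_worder slt;
  sfun : scale_car -> nat -> nat;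
  sfun_incr : forall x y, slt x y -> eventually_le (sfun x) (sfun y);
  sfun_unb : forall (K : set nat) (h : nat -> nat), infinite_set K ->
    exists x, infinite_set [set k | K k /\ (h k <= sfun x k)%N] }.

(** Monotone functions carry unboundedness from all numbers to an infinite set: a bound at the next
    point of the set is a bound before it. *)
Lemma monotone_above (h : nat -> nat) :
  exists2 m : nat -> nat, {homo m : i j / (i <= j)%N} & forall k, (h k <= m k)%N.
Proof.
exists (fun k => \max_(i < k.+1) h i) => [i j ij|k]; last first.
  exact: (@leq_bigmax _ (fun i : 'I_k.+1 => h i) ord_max).
apply/bigmax_leqP => a _.
have aj : (a < j.+1)%N by exact: leq_trans (ltn_ord a) _.
exact: (@leq_bigmax _ (fun i : 'I_j.+1 => h i) (Ordinal aj)).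
Qed.

(* Transfinite recursion along a well-order of all functions, stopped as soon as
   the functions chosen so far have no eventual upper bound; no cardinal
   arithmetic is needed. *)
Lemma scale_exists : exists S : scale, True.
Proof.
have [lt wo] := worder_exists (nat -> nat).
have wf : well_founded lt by case: wo.
pose ok f (r : forall e, lt e f -> nat -> nat) m :=
  [/\ {homo m : i j / (i <= j)%N}, forall k, (f k <= m k)%N &
      forall e ef, eventually_le (r e ef) m].
pose step f r :=
  if pselect (exists m, ok f r m) is left H then projT1 (cid H) else f.
pose G := Fix wf (fun _ => nat -> nat) step.
have GE f : G f = step f (fun e _ => G e).
  rewrite /G Fix_eq // => x r r' rr'.
  have -> // : r = r'; apply: functional_extensionality_dep => y.
  by apply: functional_extensionality_dep => p; exact: rr'.
pose good f := exists m, ok f (fun e _ => G e) m.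
have Gok f : good f -> ok f (fun e _ => G e) (G f).
  move=> gf; rewrite [G f]GE /step; case: pselect => // H.
  exact: (projT2 (cid H)).
(* [D] is the initial segment before the recursion first fails; at a failure [step] returns the
   dummy value [f]. *)
pose D f := good f /\ forall e, lt e f -> good e.
have unb (h : nat -> nat) : exists2 f, D f & ~ eventually_le (G f) h.
  apply: contrapT => N.
  have bd f : D f -> eventually_le (G f) h.
    by move=> Df; apply: contrapT => nh; apply: N; exists f.
  have all f : good f.
    elim/(well_founded_ind wf) : f => f IH.
    have [m mm hm] := monotone_above (fun k => maxn (h k) (f k)).
    exists m; split=> //.
      by move=> k; apply: leq_trans (hm k); exact: leq_maxr.
    move=> e ef; apply: eventually_le_trans (bd e _) _.
      by split; [exact: IH|move=> c ce; apply: IH; exact: (wo_trans wo ce ef)].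
    by exists 0%N => k _; apply: leq_trans (hm k); exact: leq_maxl.
  (* Since [G f] lies above [f], the argument [h + 1] contradicts the bound [h]. *)
  have [_ hle _] := Gok _ (all (fun k => (h k).+1)).
  have [M GM] := bd (fun k => (h k).+1) (conj (all _) (fun e _ => all e)).
  by have := leq_trans (hle M) (GM M (leqnn M)); rewrite ltnn.
pose C := {f : nat -> nat | `[< D f >]}.
have wo' : is_worder (fun x y : C => lt (val x) (val y)).
  exact: (wo_pullback wo val_inj).
have incr (x y : C) : lt (val x) (val y) ->
    eventually_le (G (val x)) (G (val y)).
  move: x y => [x Dx] [y /= Dy] xy; have [gy _] := asboolW Dy.
  by have [_ _] := Gok _ gy; exact.
suff unbC (K : set nat) h : infinite_set K ->
    exists x : C, infinite_set [set k | K k /\ (h k <= G (val x) k)%N].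
  by exists (@Scale C _ wo' (fun f => G (val f)) incr unbC).
move=> /infinite_natP infK; apply: contrapT => N.
have /choice[next nextP] : forall n, exists k, K k /\ (n <= k)%N.
  by move=> n; have [k] := infK n; exists k.
have [f Df] := unb (fun n => h (next n)); apply.
have {}N : ~ infinite_set [set k | K k /\ (h k <= G f k)%N].
  move=> H; apply: N; exists (exist _ f (asboolT Df)); exact: H.
have [n nP] : exists n, forall k, K k -> (n <= k)%N -> (G f k < h k)%N.
  apply: contrapT => H; apply: N; apply/infinite_natP => n.
  apply: contrapT => H'; apply: H; exists n => k Kk nk.
  by rewrite ltnNge; apply/negP => hk; apply: H'; exists k.
exists n => k nk; have [Kn kn] := nextP k.
apply: leq_trans (ltnW (nP _ Kn (leq_trans nk kn))).
have [gf _] := Df; have [mono _ _] := Gok _ gf; exact: mono.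
Qed.

(** * Strict suprema of countable sequences in a scale *)

Section Scale.
Variable S : scale.
Local Notation lt := (@slt S).
Local Notation wo := (slt_wo S).
Local Notation g := (@sfun S).

Lemma sfun_le x y : ~ lt y x -> eventually_le (g x) (g y).
Proof.
by move=> /(wo_ltW wo)[->|/sfun_incr //]; exists 0%N.
Qed.

Lemma scale_bounded (z : nat -> S) : exists x, forall n, lt (z n) x.
Proof.
have [h hP] := eventually_le_sup (fun n => g (z n)).
have [x xP] := @sfun_unb S setT (fun k => (h k).+1) infinite_nat.
exists x => n; apply: contrapT => /sfun_le/eventually_le_trans /(_ (hP n))[N NP].
have {}xP := (infinite_natP _).1 xP N.
by have [k [_ /leq_trans/(_ (NP k _))]] := xP => + Nk; rewrite ltnn => /(_ Nk).
Qed.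

Lemma lsup_exists (z : nat -> S) : exists x, (forall n, lt (z n) x) /\
  forall y, lt y x -> exists n, ~ lt (z n) y.
Proof.
have [x zx xmin] := wo_least wo (scale_bounded z : [set x | forall n, lt (z n) x] !=set0).
exists x; split=> // y yx; apply/existsNP => zy; exact: xmin zy yx.
Qed.

Definition lsup (z : nat -> S) : S := projT1 (cid (lsup_exists z)).

Lemma lsup_ub z n : lt (z n) (lsup z).
Proof. by have [+ _] := projT2 (cid (lsup_exists z)); exact. Qed.

Lemma lsup_least z y : lt y (lsup z) -> exists n, ~ lt (z n) y.
Proof. by have [_ +] := projT2 (cid (lsup_exists z)); exact. Qed.

Definition ssucc (x : S) : S := lsup (fun=> x).

Lemma ssucc_gt x : lt x (ssucc x).
Proof. exact: (lsup_ub (fun=> x) 0). Qed.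

Lemma ssucc_least x y : lt y (ssucc x) -> ~ lt x y.
Proof. by move=> /lsup_least[]. Qed.

Lemma ssucc_le x y : lt x y -> ~ lt y (ssucc x).
Proof. by move=> xy /ssucc_least. Qed.

(** Successors qualify, through constant sequences; the least index does not. A countable cofinal
    sequence is what keeps the families of the children countable. *)
Definition omega_cofinal (x : S) := exists z : nat -> S,
  (forall n, lt (z n) x) /\ forall y, lt y x -> exists n, ~ lt (z n) y.

Definition cseq (x : S) : nat -> S :=
  if pselect (omega_cofinal x) is left H then projT1 (cid H) else fun=> x.

Lemma cseq_lt x n : omega_cofinal x -> lt (cseq x n) x.
Proof.
by move=> H; rewrite /cseq; case: pselect => // H'; exact: (projT2 (cid H')).1.
Qed.

Lemma cseq_cofinal x y : omega_cofinal x -> lt y x -> exists n, ~ lt (cseq x n) y.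
Proof.
by move=> H; rewrite /cseq; case: pselect => // H'; exact: (projT2 (cid H')).2.
Qed.

Lemma omega_cofinal_lsup z : omega_cofinal (lsup z).
Proof. by exists z; split; [exact: lsup_ub|exact: lsup_least]. Qed.

End Scale.

(** * Children of a countable family *)

Definition ad (X Y : set nat) := finite_set (X `&` Y).
Definition asub (X Y : set nat) := finite_set (X `\` Y).
Definition follows (X : set nat) (F : set (set nat)) := forall W, F W -> ad X W.

Lemma adC X Y : ad X Y -> ad Y X.
Proof. by rewrite /ad setIC. Qed.

Lemma ad_sub X X' Y : X' `<=` X -> ad X Y -> ad X' Y.
Proof. by move=> XX'; apply: sub_finite_set => x [/XX' Xx]; split. Qed.

Lemma asub_refl X : asub X X.
Proof. by rewrite /asub setDv; exact: finite_set0. Qed.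

Lemma finite_setUI (T : Type) (A B : set T) :
  finite_set A -> finite_set B -> finite_set (A `|` B).
Proof. by rewrite finite_setU. Qed.

Lemma countable_setUI (T : Type) (A B : set T) :
  countable A -> countable B -> countable (A `|` B).
Proof. by move=> cA cB; rewrite -bigcup2E; apply: bigcup_countable => // -[|[|]]. Qed.

Lemma asub_trans Y X Z : asub X Y -> asub Y Z -> asub X Z.
Proof.
move=> XY YZ; apply: (@sub_finite_set _ _ ((X `\` Y) `|` (Y `\` Z))).
  by move=> x [Xx nZx]; have [Yx|nYx] := pselect (Y x); [right|left].
exact: finite_setUI.
Qed.

Lemma ad_asub Y X Z : ad X Y -> asub Z Y -> ad X Z.
Proof.
move=> XY ZY; apply: (@sub_finite_set _ _ ((X `&` Y) `|` (Z `\` Y))).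
  by move=> x [Xx Zx]; have [Yx|nYx] := pselect (Y x); [left|right].
exact: finite_setUI.
Qed.

Lemma adCP X Y : ad X (~` Y) <-> asub X Y.
Proof. by rewrite /ad /asub setDE. Qed.

Lemma follows_sub X X' F : X' `<=` X -> follows X F -> follows X' F.
Proof. by move=> XX' XF W FW; exact: ad_sub XX' (XF W FW). Qed.

Lemma thin_subset (U : nat -> set nat) (B : set nat) :
  (forall N, infinite_set (B `\` \bigcup_(j in `I_N) U j)) ->
  exists C, [/\ C `<=` B, infinite_set C & forall j, ad C (U j)].
Proof.
move=> H; have /choice[p pP] : forall n, exists q,
    (B `\` \bigcup_(j in `I_n) U j) q /\ (n <= q)%N.
  by move=> n; have [q] := (infinite_natP _).1 (H n) n; exists q.
exists (range p); split.
- by move=> _ [n _ <-]; have [[]] := pP n.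
- by apply/infinite_natP => n; exists (p n); [exists n|exact: (pP n).2].
- move=> j; apply: sub_finite_set (finite_image p (finite_II j.+1)).
  move=> _ [[n _ <-] Ujp]; exists n => //=; rewrite ltnS leqNgt; apply/negP => jn.
  by have [[_ +] _] := pP n; apply; exists j.
Qed.

Definition enum (F : set (set nat)) : nat -> set nat :=
  if pselect (exists f : nat -> set nat, F = range f) is left H
  then projT1 (cid H) else fun=> set0.

Lemma enumP F : countable F -> F !=set0 -> F = range (enum F).
Proof.
move=> /pfcard_geP[->[]//|/surjfunPex[f Ff] _].
rewrite /enum; case: pselect => [H|[]]; last by exists f.
exact: (projT2 (cid H)).
Qed.

(* [B] meets infinitely many columns of the countable partition generated by [F]
   in an infinite set. *)
Definition pos (F : set (set nat)) (B : set nat) :=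
  forall D, finite_set D -> D `<=` F ->
    exists2 W, F W & infinite_set (B `&` W `\` \bigcup_(Z in D) Z).

Lemma posW F B D : pos F B -> finite_set D -> D `<=` F ->
  infinite_set (B `\` \bigcup_(Z in D) Z).
Proof.
move=> pB finD DF; have [W _] := pB D finD DF; apply: sub_infinite_set.
by move=> x [[]].
Qed.

Lemma pos_neq0 F B : pos F B -> F !=set0.
Proof.
by move=> /(_ set0 (finite_set0 _))[|W FW _]; [exact: sub0set|exists W].
Qed.

Section Step.
Variable S : scale.
Local Notation lt := (@slt S).
Local Notation wo := (slt_wo S).
Local Notation g := (@sfun S).
Implicit Types (F : set (set nat)) (x y : S) (B a : set nat).

(* The part below the function [g x], columns being those of the enumeration
   of [F] made disjoint. *)
Definition region F x : set nat := [set p | exists k,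
  [/\ enum F k p, forall j, (j < k)%N -> ~ enum F j p & (p <= g x k)%N]].

(** From some column on the bounds are ordered, and the finitely many columns before it contribute
    only points below their finitely many bounds. *)
Lemma region_asub F x y : ~ lt y x -> asub (region F x) (region F y).
Proof.
move=> /sfun_le[N gN]; apply: sub_finite_set (finite_II (\max_(k < N) g x k).+1).
move=> p [[k [Vk nV pk]] nR] /=; rewrite ltnS.
have kN : (k < N)%N.
  rewrite ltnNge; apply/negP => Nk; apply: nR; exists k; split=> //.
  exact: leq_trans pk (gN k Nk).
exact: leq_trans pk (@leq_bigmax _ (fun i : 'I_N => g x i) (Ordinal kN)).
Qed.

Lemma region_ad F x W : countable F -> F W -> ad (region F x) W.
Proof.
move=> cF FW; have := FW; rewrite {1}(enumP cF (ex_intro _ W FW)) => -[m _ <-].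
apply: sub_finite_set (finite_II (\max_(k < m.+1) g x k).+1).
move=> p [[k [Vk nV pk]] Vm] /=; rewrite ltnS.
have km : (k < m.+1)%N by rewrite ltnS leqNgt; apply/negP => /nV.
exact: leq_trans pk (@leq_bigmax _ (fun i : 'I_m.+1 => g x i) (Ordinal km)).
Qed.

(** Among the columns met infinitely often outside the first [n], the one of least index loses only
    a finite set when all earlier columns are removed as well. *)
Lemma pos_columns F B : countable F -> pos F B ->
  infinite_set [set k | infinite_set (B `&` (enum F k `\` \bigcup_(j in `I_k) enum F j))].
Proof.
move=> cF pB; have FE := enumP cF (pos_neq0 pB).
apply/infinite_natP => n.
have [||W] := pB (enum F @` `I_n); first exact/finite_image/finite_II.
  by move=> _ [j _ <-]; have : range (enum F) (enum F j); [exists j|rewrite -FE].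
rewrite bigcup_image {1}FE => -[m _ <-] inf.
have /ex_minnP[k /asboolP infk kmin] :
    exists k, `[< infinite_set (B `&` enum F k `\` \bigcup_(j in `I_n) enum F j) >].
  by exists m; apply/asboolP.
exists k; last first.
  rewrite leqNgt; apply/negP => kn; apply: infk.
  apply: sub_finite_set (finite_set0 _) => p [[_ Vp] nV]; by apply: nV; exists k.
pose Q := \bigcup_(j in `I_k) (B `&` enum F j `\` \bigcup_(i in `I_n) enum F i).
have finQ : finite_set Q.
  apply: bigcup_finite; first exact: finite_II.
  move=> j jk; apply: contrapT => infj.
  by have := kmin j (asboolT infj); rewrite leqNgt jk.
apply: sub_infinite_set (infinite_setD infk finQ) => p [[[Bp Vp] nV] nQ].
split=> //; split=> // -[j jk Vj]; apply: nQ; exists j => //; split=> //.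
Qed.

(** In each disjointed column that [B] meets infinitely often, pick a point [h k] of [B] above
    [g y k]. Unboundedness gives an [x] whose function reaches [h] on infinitely many of these
    columns. *)
Lemma pos_region F B y : countable F -> pos F B ->
  exists2 x, lt y x & infinite_set (B `&` region F x `\` region F y).
Proof.
move=> cF pB; set col := fun k => B `&` (enum F k `\` \bigcup_(j in `I_k) enum F j).
have infK := pos_columns cF pB.
have /choice[h hP] : forall k, exists p, infinite_set (col k) ->
    col k p /\ (g y k < p)%N.
  move=> k; have [inf|fin] := pselect (infinite_set (col k)); last by exists 0%N.
  by have [p cp gp] := (infinite_natP _).1 inf (g y k).+1; exists p.
have [x infx] := @sfun_unb S _ h infK.
set I := [set k | _ /\ _] in infx.
have hI k : I k -> (B `&` region F x `\` region F y) (h k).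
  move=> [/hP[[Bh [Vh nV]] gh] hx]; split.
    by split=> //; exists k; split=> // j jk Vj; apply: nV; exists j.
  move=> [m [Vm nVm hm]].
  have mk : m = k.
    apply/eqP; rewrite eqn_leq; apply/andP; split; rewrite leqNgt; apply/negP.
      by move=> /nVm.
    by move=> mk; apply: nV; exists m.
  by move: hm; rewrite mk leqNgt gh.
have infR : infinite_set (B `&` region F x `\` region F y).
  have himg : infinite_set (h @` I).
    rewrite (eq_finite_set (inj_card_eq _)) // => i j /set_mem[/hP[[_ [Vi nVi]] _] _].
    move=> /set_mem[/hP[[_ [Vj nVj]] _] _] hij; apply/eqP; rewrite eqn_leq.
    apply/andP; split; rewrite leqNgt; apply/negP => ij.
      by apply: nVi; exists j => //; rewrite hij.
    by apply: nVj; exists i => //; rewrite -hij.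
  by apply: sub_infinite_set himg => _ [k Ik <-]; exact: hI.
exists x => //; apply: contrapT => yx; apply: infR.
by apply: sub_finite_set (region_asub F yx) => p [[_ Rp] nRp].
Qed.

(** A set almost disjoint from all members is, modulo finite, inside the region of [x] and outside
    every region of smaller index. The cofinal sequence replaces the possibly uncountable set of
    smaller indices. *)
Definition step F x : set (set nat) :=
  F `|` ([set ~` region F x] `|` range (fun m => region F (cseq x m))).

Lemma step_countable F x : countable F -> countable (step F x).
Proof.
move=> cF; apply: countable_setUI => //.
apply: countable_setUI; first exact: finite_set_countable.
exact: (card_le_trans (card_image_le _ _)).
Qed.

Lemma step_region F x y : omega_cofinal x -> lt y x ->
  exists2 W, step F x W & asub (region F y) W.
Proof.
move=> cx yx; have [m ym] := cseq_cofinal cx yx.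
exists (region F (cseq x m)); first by right; right; exists m.
exact: region_asub.
Qed.

Lemma follows_step_region F x y a : omega_cofinal x -> follows a (step F x) ->
  lt y x -> ad a (region F y).
Proof.
move=> cx ax yx; have [W sW RW] := step_region F cx yx.
exact: ad_asub (ax W sW) RW.
Qed.

Lemma follows_step_asub F x a : follows a (step F x) -> asub a (region F x).
Proof. by move=> ax; apply/adCP; apply: ax; right; left. Qed.

Lemma follows_step_sub F x a : follows a (step F x) -> follows a F.
Proof. by move=> ax W FW; apply: ax; left. Qed.

(** If [x'] is smaller, [a] is almost inside the region of [x'], hence in a region of the cofinal
    sequence of [x]. If [x] is smaller, [a] almost misses the region of [x], whose complement is a
    member. *)
Lemma step_separates F x x' a : omega_cofinal x -> omega_cofinal x' ->
  x <> x' -> follows a (step F x') -> exists2 W, step F x W & asub a W.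
Proof.
move=> cx cx' xx' ax'; case: (wo_total wo x' x) => [x'x|/esym//|xx'lt].
  have [W sW RW] := step_region F cx x'x; exists W => //.
  exact: asub_trans (follows_step_asub ax') RW.
exists (~` region F x); first by right; left.
apply: sub_finite_set (follows_step_region cx' ax' xx'lt) => p [ap nn].
by split=> //; exact: contrapT nn.
Qed.

(** The regions of the cofinal sequence that occur in a finite [D] are all almost inside
    [region F y] for one [y] below [x]. Then [Y] almost misses the union of [D], while some member
    almost covers [Y]. *)
Lemma pos_step_criterion F B x : omega_cofinal x ->
  (forall y, lt y x -> exists Y y', [/\ infinite_set Y, Y `<=` B,
    ad Y (region F y), follows Y F & lt y' x /\ asub Y (region F y')]) ->
  pos (step F x) B.
Proof.
move=> cx H D /finite_seqP[s ->] sD.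
have [y yx yP] : exists2 y, lt y x & forall Z, Z \in s ->
    [\/ F Z, Z = ~` region F x | exists2 u, ~ lt y u & Z = region F u].
  elim: s sD => [|Z s IH] sD; first by exists (cseq x 0) => //; exact: cseq_lt.
  have [|y yx yP] := IH.
    by move=> W Ws; apply: sD; rewrite /= inE Ws orbT.
  have : step F x Z by apply: sD; rewrite /= inE eqxx.
  move=> [FZ|[->|[m _ <-]]].
  - by exists y => // W; rewrite inE => /predU1P[->|/yP//]; exact: Or31.
  - by exists y => // W; rewrite inE => /predU1P[->|/yP//]; exact: Or32.
  - have [ym|ym] := pselect (lt y (cseq x m)).
      exists (cseq x m); first exact: cseq_lt.
      move=> W; rewrite inE => /predU1P[->|/yP[?|?|[u yu ->]]].
      + by apply: Or33; exists (cseq x m) => //; exact: (wo_irr wo).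
      + exact: Or31.
      + exact: Or32.
      + apply: Or33; exists u => // mu; apply: yu; exact: (wo_trans wo ym mu).
    exists y => // W; rewrite inE => /predU1P[->|/yP//].
    by apply: Or33; exists (cseq x m).
have [Y [y' [infY YB Yy YF [y'x Yy']]]] := H y yx.
have [W sW RW] := step_region F cx y'x.
exists W => //.
have finD : finite_set (Y `&` \bigcup_(Z in [set` s]) Z).
  rewrite setI_bigcupr; apply: bigcup_finite; first exact: finite_seq.
  move=> Z /yP[/YF//|->|[u yu ->]].
    apply/adCP; apply: asub_trans Yy' _; apply: region_asub => xy'.
    exact: (wo_irr wo (wo_trans wo xy' y'x)).
  exact: ad_asub Yy (region_asub F yu).
have finW := asub_trans Yy' RW.
apply: sub_infinite_set (infinite_setD infY (finite_setUI finW finD)).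
move=> p [Yp nU]; split; last by move=> Dp; apply: nU; right.
by split; [exact: YB|apply: contrapT => nW; apply: nU; left].
Qed.

(** Iterating [pos_region] gives increasing indices between which [B] always gains infinitely many
    points; their supremum is the required child. *)
Lemma pos_step F B y : countable F -> pos F B ->
  exists x, [/\ lt y x, omega_cofinal x & pos (step F x) B].
Proof.
move=> cF pB.
have /choice[next nextP] : forall u, exists x, lt u x /\
    infinite_set (B `&` region F x `\` region F u).
  by move=> u; have [x] := pos_region u cF pB; exists x.
pose z n := iter n next y.
have zS n : z n.+1 = next (z n) by [].
exists (lsup z); split; [exact: (lsup_ub z 0)|exact: omega_cofinal_lsup|].
apply: pos_step_criterion; first exact: omega_cofinal_lsup.
move=> u /lsup_least[n zu].
exists (B `&` region F (z n.+1) `\` region F (z n)), (z n.+1); split.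
- by rewrite zS; exact: (nextP (z n)).2.
- by move=> p [[]].
- apply: ad_asub (region_asub F zu); apply: sub_finite_set (finite_set0 _).
  by move=> p [[_]].
- by move=> W FW; apply: ad_sub (region_ad (z n.+1) cF FW) => p [[]].
- split; first exact: lsup_ub.
  apply: sub_finite_set (finite_set0 _).
  by move=> p [[[_ Rp] _]].
Qed.

(* Infinitely many different children of a node accumulate to another child, at
   the least index below which infinitely many of them lie. *)
Lemma pos_step_fan F B (a : nat -> set nat) (x : nat -> S) : injective x ->
  (forall n, omega_cofinal (x n)) -> (forall n, follows (a n) (step F (x n))) ->
  (forall n, infinite_set (a n `&` B)) ->
  exists y, omega_cofinal y /\ pos (step F y) B.
Proof.
move=> xinj cx ax infa.
have [u xu] := scale_bounded x.
have [|y infy ymin] := @wo_least _ _ wo [set v | infinite_set [set n | lt (x n) v]].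
  exists u; apply: sub_infinite_set infinite_nat => n _; exact: xu.
have between v : lt v y -> exists n, lt v (x n) /\ lt (x n) y.
  move=> vy; have fin : finite_set [set n | lt (x n) v].
    by apply: contrapT => inf; exact: ymin inf vy.
  have fin' : finite_set [set n | x n = v].
    have [[m mv]|N] := pselect (exists m, x m = v).
      by apply: sub_finite_set (finite_set1 m) => n /= xn; apply: xinj; rewrite mv.
    by apply: sub_finite_set (finite_set0 _) => n /= xn; apply: N; exists n.
  have [n [xny nU]] := infinite_setN0 (infinite_setD infy
    (finite_setUI fin fin')).
  exists n; split=> //; case: (wo_total wo v (x n)) => // [vx|xv].
    by exfalso; apply: nU; right.
  by exfalso; apply: nU; left.
have [n0 xn0] := infinite_setN0 infy.
have cy : omega_cofinal y.
  (* Terms not below [y] are replaced by [x n0], so that the whole sequence stays below [y]. *)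
  exists (fun n => if pselect (lt (x n) y) is left _ then x n else x n0).
  split=> [n|v /between[n [vn ny]]]; first by case: pselect.
  exists n; case: pselect => // _; exact: (wo_leN wo (or_intror vn)).
exists y; split=> //; apply: pos_step_criterion => // v /between[n [vn ny]].
exists (a n `&` B), (x n); split=> //.
- apply: (@ad_sub (a n)) => [p []//|]; exact: follows_step_region (cx n) (ax n) vn.
- by apply: (@follows_sub (a n)) => [p []//|]; exact: follows_step_sub (ax n).
- split=> //; apply: sub_finite_set (follows_step_asub (ax n)).
  by move=> p [[]].
Qed.

End Step.

(** * The tree of families *)

Section Tree.
Variables (S : scale) (base : set (set nat)).
Local Notation lt := (@slt S).
Local Notation wo := (slt_wo S).

(** At each level a branch records the family of its node and the index of the child taken there.
    For an element only the levels below [len] are meaningful. *)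
Definition coord : Type := (set (set nat) * S)%type.

Record elt := Elt { branch : S -> coord; len : S; body : set nat }.

Implicit Types (P : set elt) (x y : S -> coord) (e : elt) (i j l : S).

Definition fam x i := (x i).1.
Definition ord x i := (x i).2.
Definition below x i := step (fam x i) (ord x i).
Definition agree x y j := forall i, lt i j -> x i = y i.

(* [F] is a legitimate family for the node [x] restricted to the levels below
   [j]: what the node inherits, plus the bodies of the elements of [P] attached
   at that very node. *)
Record good_at P x j (F : set (set nat)) : Prop := GoodAt {
  ga_countable : countable F;
  ga_base : base `<=` F;
  ga_below : forall i, lt i j -> below x i `<=` F;
  ga_succ : forall i, j = ssucc i -> F = below x i;
  ga_exact : forall W, F W ->
    [\/ base W, exists2 i, lt i j & below x i W |
        exists2 e, P e & [/\ len e = j, agree (branch e) x j & body e = W]];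
  ga_pass : forall e, P e -> agree (branch e) x j -> lt j (len e) ->
    fam (branch e) j = F;
  ga_end : forall e, P e -> agree (branch e) x j -> len e = j -> F (body e) }.

Definition good_path P x l := forall j, lt j l ->
  omega_cofinal (ord x j) /\ good_at P x j (fam x j).

(** Elements end at limit levels only, so nothing is attached at a successor node and its family is
    exactly the [step] of its predecessor. *)
Definition proper e := [/\ exists i, lt i (len e),
  forall j, lt j (len e) -> lt (ssucc j) (len e),
  infinite_set (body e) &
  forall j, lt j (len e) -> follows (body e) (below (branch e) j)].

Definition coherent P := [/\ forall e, P e -> good_path P (branch e) (len e),
  forall e, P e -> proper e &
  forall e e', P e -> P e' -> len e = len e' ->
    agree (branch e) (branch e') (len e) -> e = e'].

(** The last clause makes the node at the end of the branch free: no element of [P] ends there or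
    passes through it. *)
Definition extends P e := [/\ good_path P (branch e) (len e), proper e &
  forall e', P e' -> agree (branch e') (branch e) (len e) -> lt (len e') (len e)].

Lemma agreeC x y j : agree x y j -> agree y x j.
Proof. by move=> xy i ij; rewrite xy. Qed.

Lemma agree_trans y x z j : agree x y j -> agree y z j -> agree x z j.
Proof. by move=> xy yz i ij; rewrite xy // yz. Qed.

Lemma agree_le x y i j : agree x y j -> ~ lt j i -> agree x y i.
Proof. by move=> xy ji k ki; apply: xy; exact: (wo_lt_le wo ki ji). Qed.

Lemma agree_below x y i j : agree x y j -> lt i j -> below x i = below y i.
Proof. by move=> xy ij; rewrite /below /fam /ord xy. Qed.

Lemma good_at_agree P x y j F : agree x y j -> good_at P x j F -> good_at P y j F.
Proof.
move=> xy [cF bF uF sF eF pF dF]; split=> //.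
- by move=> i ij; rewrite -(agree_below xy ij); exact: uF.
- by move=> i ji; rewrite (sF i ji) (agree_below xy) // ji; exact: ssucc_gt.
- move=> W /eF[bW|[i ij Wi]|[e Pe [le ae be]]]; first exact: Or31.
    by apply: Or32; exists i => //; rewrite -(agree_below xy ij).
  by apply: Or33; exists e => //; split=> //; exact: agree_trans xy.
- by move=> e Pe ae; apply: pF => //; exact: agree_trans (agreeC xy).
- by move=> e Pe ae; apply: dF => //; exact: agree_trans (agreeC xy).
Qed.

Lemma good_at_sub P P' x j F :
  P `<=` P' -> good_at P x j F ->
  (forall e, P' e -> ~ P e -> agree (branch e) x j -> lt j (len e) ->
    fam (branch e) j = F) ->
  (forall e, P' e -> ~ P e -> agree (branch e) x j -> len e = j -> F (body e)) ->
  good_at P' x j F.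
Proof.
move=> PP' [cF bF uF sF eF pF dF] pF' dF'; split=> //.
- move=> W /eF[?|?|[e Pe ?]]; [exact: Or31|exact: Or32|].
  by apply: Or33; exists e => //; exact: PP'.
- by move=> e P'e; have [Pe|nPe] := pselect (P e); [exact: pF|exact: pF'].
- by move=> e P'e; have [Pe|nPe] := pselect (P e); [exact: dF|exact: dF'].
Qed.

(** Good paths survive later stages. A later element passing a node of an earlier branch had to
    carry the same family there, and it could not end there, because its own end had to be free of
    the earlier element. *)
Lemma coherent_range (T : Type) (tlt : T -> T -> Prop) (h : T -> option elt)
    (D : set T) : is_worder tlt ->
  (forall s t, tlt s t -> D t -> D s) ->
  (forall t e, h t = Some e ->
    extends [set e' | exists2 s, tlt s t & h s = Some e'] e) ->
  coherent [set e | exists2 t, D t & h t = Some e].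
Proof.
move=> tw Dd hE; pose P t := [set e' | exists2 s, tlt s t & h s = Some e'].
split.
- move=> e [t Dt ht] j je; have [gp _ ne] := hE _ _ ht.
  have [oc ga] := gp j je; split=> //.
  have late s e' : h s = Some e' -> ~ P t e' -> e' <> e -> tlt t s.
    move=> hs nP ee'; case: (wo_total tw t s) => [//|ts|st].
      by exfalso; apply: ee'; move: hs; rewrite -ts ht => -[].
    by exfalso; apply: nP; exists s.
  apply: good_at_sub ga _ _.
  + by move=> e' [s st hs]; exists s => //; exact: Dd st Dt.
  + move=> e' [s Ds hs] nP ae je'.
    have [->//|ee'] := pselect (e' = e).
    have [gp' _ _] := hE _ _ hs; have [_ ga'] := gp' j je'.
    rewrite -(ga_pass ga' _ (agreeC ae) je) //.
    by exists t => //; exact: late hs nP ee'.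
  + move=> e' [s Ds hs] nP ae lj.
    have ee' : e' <> e.
      by move=> E; move: je; rewrite -lj E; exact: (wo_irr wo).
    have [_ _ ne'] := hE _ _ hs.
    have : lt (len e) (len e').
      apply: ne'; first by exists t => //; exact: late hs nP ee'.
      by rewrite lj; exact: agreeC.
    by rewrite lj => /(wo_trans wo je)/(wo_irr wo).
- by move=> e [t _ ht]; have [] := hE _ _ ht.
- move=> e e' [t _ ht] [s _ hs] ll aee'.
  case: (wo_total tw t s) => [ts|ts|st].
  + have [_ _ ne] := hE _ _ hs.
    have : lt (len e) (len e') by apply: ne; [exists t|rewrite -ll].
    by rewrite ll => /(wo_irr wo).
  + by move: hs; rewrite -ts ht => -[].
  + have [_ _ ne] := hE _ _ ht.
    have : lt (len e') (len e) by apply: ne; [exists s|exact: agreeC].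
    by rewrite ll => /(wo_irr wo).
Qed.

Section Coherent.
Variable P : set elt.
Hypothesis cohP : coherent P.

Let gpP e : P e -> good_path P (branch e) (len e).
Proof. by case: cohP => + _ _; exact. Qed.
Let prP e : P e -> proper e.
Proof. by case: cohP => _ + _; exact. Qed.
Let uniqP e e' : P e -> P e' -> len e = len e' ->
  agree (branch e) (branch e') (len e) -> e = e'.
Proof. by case: cohP => _ _; exact. Qed.

Lemma body_follows_base e : P e -> follows (body e) base.
Proof.
move=> Pe; have [[i il] _ _ fo] := prP Pe => W bW.
apply: (fo i il); left; have [_ ga] := gpP Pe il; exact: ga_base ga _ bW.
Qed.

(** Either the element ends at this node, whose family then contains its body, or it takes a
    different child and [step_separates] applies. *)
Lemma body_covered x j e : P e -> omega_cofinal (ord x j) ->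
  good_at P x j (fam x j) -> agree (branch e) x j -> ~ lt (len e) j ->
  (lt j (len e) -> branch e j <> x j) ->
  exists2 W, below x j W & asub (body e) W.
Proof.
move=> Pe oc ga ae lj ne; case: (wo_ltW wo lj) => [jl|jl].
  exists (body e); last exact: asub_refl.
  by left; exact: (ga_end ga Pe ae (esym jl)).
have fE := ga_pass ga Pe ae jl.
have [oc' _] := gpP Pe jl.
apply: (step_separates oc oc').
  move=> oE; apply: (ne jl); move: fE oE; rewrite /fam /ord.
  by case: (branch e j) (x j) => [u v] [u' v'] /= -> ->.
by rewrite -fE; case: (prP Pe) => _ _ _ /(_ j jl).
Qed.

Lemma first_difference e e' : exists j, [/\ agree (branch e) (branch e') j,
  ~ lt (len e) j, ~ lt (len e') j &
  ~ [/\ lt j (len e), lt j (len e') & branch e j = branch e' j]].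
Proof.
have [|j nj jmin] := @wo_least _ _ wo
  [set j | ~ [/\ lt j (len e), lt j (len e') & branch e j = branch e' j]].
  by exists (len e) => -[/(wo_irr wo)].
have below_j i : lt i j -> [/\ lt i (len e), lt i (len e') & branch e i = branch e' i].
  by move=> ij; apply: contrapT => /jmin; exact.
exists j; split=> //.
- by move=> i /below_j[].
- by move=> /below_j[/(wo_irr wo)].
- by move=> /below_j[_ /(wo_irr wo)].
Qed.

(** At the first difference one of the two elements goes on, by uniqueness. Its body is almost
    disjoint from every member of the child it takes, and one such member almost covers the other
    body. *)
Lemma coherent_ad e e' : P e -> P e' -> e <> e' -> ad (body e) (body e').
Proof.
move=> Pe Pe' ee'.
have [j [aj lj lj' nj]] := first_difference e e'.
have aux f f' : P f -> P f' -> agree (branch f) (branch f') j -> lt j (len f) ->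
    ~ lt (len f') j -> ~ [/\ lt j (len f), lt j (len f') & branch f j = branch f' j] ->
    ad (body f) (body f').
  move=> Pf Pf' af jf jf' nf; have [oc ga] := gpP Pf jf.
  have [|W sW bW] := body_covered Pf' oc ga (agreeC af) jf'.
    by move=> jl pE; apply: nf; split=> //; rewrite pE.
  by case: (prP Pf) => _ _ _ /(_ j jf W sW) adW; exact: ad_asub adW bW.
case: (wo_ltW wo lj) => [jE|je]; last exact: aux je lj' nj.
case: (wo_ltW wo lj') => [jE'|je'].
  by exfalso; apply: ee'; apply: uniqP => //; rewrite ?jE -?jE' // -jE.
apply: adC; apply: aux je' lj _ => //; first exact: agreeC.
by move=> [? ? pE]; apply: nj; split.
Qed.

Lemma good_at_succ x j : omega_cofinal (ord x j) -> good_at P x j (fam x j) ->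
  good_at P x (ssucc j) (below x j).
Proof.
move=> oc ga.
have ssucc_inj i : ssucc j = ssucc i -> i = j.
  move=> ji; case: (wo_total wo i j) => // [ij|jlt].
    by have := ssucc_least (_ : lt j (ssucc i)); rewrite -ji => /(_ (ssucc_gt j)).
  by have := ssucc_least (_ : lt i (ssucc j)); rewrite ji => /(_ (ssucc_gt i)).
split.
- exact: step_countable (ga_countable ga).
- by move=> W /(ga_base ga); left.
- move=> i /ssucc_least/(wo_ltW wo)[->//|ij W Wi]; left; exact: ga_below ga _ ij _ Wi.
- by move=> i /ssucc_inj ->.
- by move=> W Wj; apply: Or32; exists j => //; exact: ssucc_gt.
- move=> e Pe ae le; have [_ ge] := gpP Pe le.
  by rewrite (ga_succ ge erefl) (agree_below ae (ssucc_gt j)).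
- move=> e Pe _ le; have [_ lim _ _] := prP Pe.
  by have := lim j; rewrite le => /(_ (ssucc_gt j))/(wo_irr wo).
Qed.

Lemma good_root B : countable base -> pos base B ->
  exists x l F, [/\ good_path P x l, good_at P x l F & pos F B].
Proof.
move=> cb pb; have [s0 _] := @sfun_unb S _ (fun=> 0%N) infinite_nat.
have [|l _ lmin] := @wo_least _ _ wo setT; first by exists s0.
have {}lmin i : ~ lt i l by exact: lmin.
(* The path is a dummy, since no level lies below the least one. *)
exists (fun=> (set0, l)), l, base; split=> //; first by move=> j /lmin.
split=> //.
- by move=> i /lmin.
- by move=> i li; have := lmin i; rewrite li => /(_ (ssucc_gt i)).
- by move=> W bW; exact: Or31.
- move=> e Pe _ le; have [_ ge] := gpP Pe le; apply/seteqP; split.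
    move=> W /(ga_exact ge)[//|[i /lmin//]|[e' Pe' [le' _ _]]].
    by have [[i]] := prP Pe'; rewrite le' => /lmin.
  exact: ga_base ge.
- by move=> e Pe _ le; have [[i]] := prP Pe; rewrite le => /lmin.
Qed.

End Coherent.
End Tree.

(** * Extending a coherent system along a free branch *)

Section Extend.
Variables (S : scale) (base : set (set nat)) (P : set (elt S)).
Hypothesis cohP : coherent base P.
Local Notation lt := (@slt S).
Local Notation wo := (slt_wo S).
Variables (x : S -> coord S) (l : S) (F : set (set nat)) (B : set nat).
Hypotheses (gx : good_path base P x l) (gF : good_at base P x l F)
  (pF : pos F B).

(** A second use of [pos_step], above the first child, gives a different one. Choosing for all
    families at once fixes a binary subtree above the given node. *)
Lemma two_children : exists c : set (set nat) -> bool -> S,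
  forall G, countable G -> pos G B ->
    c G true <> c G false /\
    forall b, omega_cofinal (c G b) /\ pos (step G (c G b)) B.
Proof.
suff /choice[c cP] : forall G, exists c : bool -> S,
    countable G -> pos G B -> c true <> c false /\
    forall b, omega_cofinal (c b) /\ pos (step G (c b)) B by exists c.
move=> G.
have [[cG pG]|N] := pselect (countable G /\ pos G B); last first.
  by exists (fun=> l) => cG pG; exfalso; exact: N.
have [u [_ cu pu]] := pos_step l cG pG.
have [v [uv cv pv]] := pos_step u cG pG.
exists (fun b => if b then u else v) => _ _; split; last by case.
by move=> uE; move: uv; rewrite uE => /(wo_irr wo).
Qed.

Let c := projT1 (cid two_children).
Let cP := projT2 (cid two_children).

Fixpoint node_fam (b : nat -> bool) n : set (set nat) :=
  if n is n'.+1 then step (node_fam b n') (c (node_fam b n') (b n')) else F.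

Definition level n : S := iter n (@ssucc S) l.

Definition level_lim : S := lsup level.

Definition node_path (b : nat -> bool) (j : S) : coord S :=
  if pselect (exists n, j = level n) is left H
  then let n := projT1 (cid H) in (node_fam b n, c (node_fam b n) (b n))
  else x j.

Lemma level_mono m n : (m < n)%N -> lt (level m) (level n).
Proof.
elim: n => // n IH; rewrite ltnS leq_eqVlt => /predU1P[->|/IH mn].
  exact: ssucc_gt.
exact: (wo_trans wo mn (ssucc_gt _)).
Qed.

Lemma level_inj : injective level.
Proof.
move=> m n mn; apply/eqP; rewrite eqn_leq.
apply/andP; split; rewrite leqNgt; apply/negP => /level_mono;
  rewrite mn; exact: (wo_irr wo).
Qed.

Lemma node_pathE b n :
  node_path b (level n) = (node_fam b n, c (node_fam b n) (b n)).
Proof.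
rewrite /node_path; case: pselect => [H|[]]; last by exists n.
by case: (cid H) => m /= /level_inj <-.
Qed.

Lemma node_path_lt b j : lt j l -> node_path b j = x j.
Proof.
move=> jl; rewrite /node_path; case: pselect => // -[n jn].
exfalso; move: jl; rewrite jn; case: n {jn} => [/(wo_irr wo)//|n nl].
exact: (wo_irr wo (wo_trans wo nl (@level_mono 0 n.+1 isT))).
Qed.

Lemma lt_level_lim j : lt j level_lim ->
  lt j l \/ exists2 n, j = level n & True.
Proof.
move=> /lsup_least[n]; elim: n => [|n IH] jn.
  case: (wo_ltW wo jn) => [->|]; last by left.
  by right; exists 0%N.
have [nj|/IH//] := pselect (lt (level n) j).
right; exists n.+1 => //; case: (wo_ltW wo jn) => // /ssucc_least.
by move=> /(_ nj).
Qed.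

Lemma level_lt_lim n : lt (level n) level_lim.
Proof. exact: lsup_ub. Qed.

Lemma node_good b n : [/\ countable (node_fam b n), pos (node_fam b n) B &
  good_at base P (node_path b) (level n) (node_fam b n)].
Proof.
elim: n => [|n [cn pn gn]].
  split=> //; first exact: ga_countable gF.
  by apply: good_at_agree gF => i il; rewrite node_path_lt.
have [_ /(_ (b n))[oc pc]] := cP cn pn.
split=> //; first exact: step_countable.
have := @good_at_succ S base P cohP (node_path b) (level n).
by rewrite /below /fam /ord node_pathE /=; exact.
Qed.

Lemma node_cofinal b n : omega_cofinal (ord (node_path b) (level n)).
Proof.
have [cn pn _] := node_good b n; rewrite /ord node_pathE /=.
by have [_ /(_ (b n))[]] := cP cn pn.
Qed.

Lemma node_good_path b : good_path base P (node_path b) level_lim.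
Proof.
move=> j /lt_level_lim[jl|[n -> _]]; last first.
  have [_ _ gn] := node_good b n; split; first exact: node_cofinal.
  by rewrite /fam node_pathE.
have [oc ga] := gx jl; rewrite /ord /fam node_path_lt //; split=> //.
apply: good_at_agree ga => i ij; rewrite node_path_lt //.
exact: (wo_trans wo ij jl).
Qed.

Lemma node_path_inj b b' :
  agree (node_path b) (node_path b') level_lim -> b = b'.
Proof.
move=> ab.
have en n : (node_fam b n, c (node_fam b n) (b n)) =
    (node_fam b' n, c (node_fam b' n) (b' n)).
  by rewrite -!node_pathE; apply: ab; exact: level_lt_lim.
apply: functional_extensionality_dep => n.
have [fE] := en n; rewrite -fE => cE.
have [cn pn _] := node_good b n; have [cne _] := cP cn pn.
by case: (b n) (b' n) cE => -[] // /esym.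
Qed.

Lemma node_fam_mono b m n : (m <= n)%N -> node_fam b m `<=` node_fam b n.
Proof.
elim: n => [|n IH]; first by rewrite leqn0 => /eqP ->.
rewrite leq_eqVlt => /predU1P[->//|mn] W /(IH mn); by left.
Qed.

(** Finitely many members of the union of the families already belong to one node of the branch, so
    [B] stays infinite without them and can be thinned out. *)
Lemma node_body b : exists C, [/\ C `<=` B, infinite_set C &
  forall n, follows C (node_fam b n)].
Proof.
pose U := \bigcup_n node_fam b n.
have cU : countable U.
  by apply: bigcup_countable => // n _; have [] := node_good b n.
have U0 : U !=set0.
  by have [W FW] := pos_neq0 pF; exists W; exists 0%N.
have UE := enumP cU U0.
have [|C [CB infC CU]] := @thin_subset (enum U) B; last first.
  exists C; split=> // n W nW; have : U W by exists n.
  by rewrite UE => -[m _ <-].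
move=> N; have [m mP] : exists m, enum U @` `I_N `<=` node_fam b m.
  elim: N => [|N [m mP]]; first by exists 0%N => W [i].
  have [k _ kP] : U (enum U N).
    by have : range (enum U) (enum U N); [exists N|rewrite -UE].
  exists (maxn m k) => _ [i /= + <-]; rewrite ltnS leq_eqVlt => /predU1P[->|iN].
    exact: node_fam_mono (leq_maxr _ _) _ kP.
  by apply: node_fam_mono (leq_maxl _ _) _ (mP _ _); exists i.
have [_ pm _] := node_good b m.
by have := posW pm (finite_image _ (finite_II N)) mP; rewrite bigcup_image.
Qed.

(* Different branches are blocked by different elements of [P], so some branch
   has no element of [P] on it or beyond it. *)
Lemma extend : ~ continuum_le P ->
  exists2 e, extends base P e & body e `<=` B.
Proof.
move=> smallP.
have [b nb] : exists b, forall e, P e -> agree (branch e) (node_path b) level_lim ->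
    lt (len e) level_lim.
  apply: contrapT => N; apply: smallP; apply/continuum_leP.
  have /choice[f fP] : forall X : set nat, exists e,
      P e /\ agree (branch e) (node_path (fun n => `[< X n >])) level_lim.
    move=> X; apply: contrapT => NX; apply: N; exists (fun n => `[< X n >]).
    by move=> e Pe ae; exfalso; apply: NX; exists e.
  exists f => [X Y XY|X]; last exact: (fP X).1.
  have aXY : agree (node_path (fun n => `[< X n >]))
      (node_path (fun n => `[< Y n >])) level_lim.
    by apply: agree_trans (agreeC (fP X).2) _; rewrite XY; exact: (fP Y).2.
  rewrite predeqE => n; have /= En := congr1 (@^~ n) (node_path_inj aXY).
  by split=> /asboolP; [rewrite En|rewrite -En] => /asboolP.
have [C [CB infC Cf]] := node_body b.
exists (Elt (node_path b) level_lim C) => //; split=> //=.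
  exact: node_good_path.
split=> //=.
- by exists l; exact: (level_lt_lim 0).
- move=> j /lsup_least[n nj]; apply: (wo_le_lt wo _ (level_lt_lim n.+1)).
  by apply: ssucc_le; exact: (wo_le_lt wo nj (ssucc_gt _)).
- move=> j /lt_level_lim[jl|[n -> _]] W.
    rewrite /below /fam /ord node_path_lt // => Wj.
    by apply: (Cf 0%N); exact: ga_below gF _ jl _ Wj.
  by rewrite /below /fam /ord node_pathE; exact: (Cf n.+1).
Qed.

End Extend.

Lemma pos_of_teeth (F : set (set nat)) (B : set nat) (a : nat -> set nat) :
  (forall n, infinite_set (a n `&` B)) ->
  (forall Z, F Z -> exists N, forall n, (N <= n)%N -> ad (a n) Z) ->
  (forall n, exists2 W, F W & asub (a n) W) -> pos F B.
Proof.
move=> infa adF covF D /finite_seqP[s ->] sF.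
have [N NP] : exists N, forall n, (N <= n)%N -> forall Z, Z \in s -> ad (a n) Z.
  elim: s sF => [|Z s IH] sF; first by exists 0%N.
  have [|N NP] := IH; first by move=> W Ws; apply: sF; rewrite /= inE Ws orbT.
  have [|M MP] := adF Z; first by apply: sF; rewrite /= inE eqxx.
  exists (maxn N M) => n; rewrite geq_max => /andP[Nn Mn] W.
  by rewrite inE => /predU1P[->|Ws]; [exact: MP|exact: NP].
have [W FW aW] := covF N; exists W => //.
have finD : finite_set (a N `&` \bigcup_(Z in [set` s]) Z).
  rewrite setI_bigcupr; apply: bigcup_finite; first exact: finite_seq.
  by move=> Z Zs; exact: NP.
apply: sub_infinite_set (infinite_setD (infa N) (finite_setUI aW finD)).
move=> p [[ap Bp] nU]; split; last by move=> Dp; apply: nU; right.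
by split=> //; apply: contrapT => nW; apply: nU; left.
Qed.

Lemma infinite_fibers (T U : Type) (f : T -> U) (A : set T) :
  infinite_set A -> (forall u, finite_set [set t | A t /\ f t = u]) ->
  exists2 t : nat -> T, injective (f \o t) & forall n, A (t n).
Proof.
move=> infA fib; have /infiniteP/card_le_setTP[u uinj uA] : infinite_set (f @` A).
  move=> fin; apply: infA.
  have : finite_set (\bigcup_(u in f @` A) [set t | A t /\ f t = u]).
    exact: bigcup_finite.
  by apply: sub_finite_set => t At; exists (f t) => //; exists t.
have /choice[t tP] : forall n, exists t, A t /\ f t = u n.
  by move=> n; have [t At ft] := uA n; exists t.
exists t => [m n|n]; last exact: (tP n).1.
by rewrite /= !(tP _).2; exact: uinj.
Qed.

(** * Accumulation of infinitely many elements: fans and combs *)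

Section Split.
Variables (S : scale) (base : set (set nat)) (P : set (elt S)).
Hypothesis cohP : coherent base P.
Local Notation lt := (@slt S).
Local Notation wo := (slt_wo S).
Implicit Types (H : set (elt S)) (j : S).

Let gpP e : P e -> good_path base P (branch e) (len e).
Proof. by case: cohP => + _ _; exact. Qed.
Let prP e : P e -> proper e.
Proof. by case: cohP => _ + _; exact. Qed.
Let uniqP e e' : P e -> P e' -> len e = len e' ->
  agree (branch e) (branch e') (len e) -> e = e'.
Proof. by case: cohP => _ _; exact. Qed.

Definition passes (v : coord S) j : set (elt S) :=
  [set e | lt j (len e) /\ branch e j = v].

Definition common H j := exists v, H `<=` passes v j.

Definition splits H j := ~ common H j /\ forall i, lt i j -> common H i.

Lemma splits_exists H : H !=set0 -> exists j, splits H j.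
Proof.
move=> [e He]; have [|j nj jmin] := @wo_least _ _ wo [set j | ~ common H j].
  by exists (len e) => -[v] /(_ e He)[/(wo_irr wo)].
by exists j; split=> // i ij; apply: contrapT => /jmin; exact.
Qed.

Lemma common_sub H H' j : H' `<=` H -> common H j -> common H' j.
Proof. by move=> HH' [v Hv]; exists v; exact: subset_trans Hv. Qed.

Lemma common_agree H j e e' : (forall i, lt i j -> common H i) ->
  H e -> H e' -> agree (branch e) (branch e') j.
Proof. by move=> cH He He' i /cH[v Hv]; rewrite (Hv e He).2 (Hv e' He').2. Qed.

Lemma common_len H j e : (forall i, lt i j -> common H i) -> H e -> ~ lt (len e) j.
Proof. by move=> cH He /cH[v /(_ e He)[/(wo_irr wo)]]. Qed.

Variable B : set nat.

(** This is the input of [extend]; the node need not lie on the branch of an element of [P]. *)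
Definition anchored :=
  exists x l F, [/\ good_path base P x l, good_at base P x l F & pos F B].

(** At most one element ends at the splitting node, so infinitely many leave it through different
    children. All see the same family there, and [pos_step_fan] provides the child at which [B] is
    anchored. *)
Lemma fan_anchored H j : H `<=` P -> infinite_set H ->
  (forall e, H e -> infinite_set (body e `&` B)) ->
  splits H j -> (forall v, finite_set (H `&` passes v j)) -> anchored.
Proof.
move=> HP infH HB [_ cH] fin.
pose H' := H `&` [set e | lt j (len e)].
have infH' : infinite_set H'.
  have fin1 : finite_set (H `&` [set e | len e = j]).
    have [[z [Hz lz]]|nz] := pselect (exists z, H z /\ len z = j); last first.
      by apply: sub_finite_set (finite_set0 _) => e [He le]; apply: nz; exists e.
    apply: sub_finite_set (finite_set1 z) => e [He le].
    apply: uniqP; [exact: HP|exact: HP|by rewrite lz|].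
    by rewrite le; exact: common_agree cH He Hz.
  apply: sub_infinite_set (infinite_setD infH fin1) => e [He ne]; split=> //.
  case: (wo_ltW wo (common_len cH He)) => // je.
  by exfalso; apply: ne.
have [|t tinj tH'] := @infinite_fibers _ _ (fun e => branch e j) H' infH'.
  by move=> v; apply: sub_finite_set (fin v) => e [[He je] pe].
have tH n : H (t n) by case: (tH' n).
have tj n : lt j (len (t n)) by case: (tH' n).
pose F := fam (branch (t 0)) j.
have [_ g0] := gpP (HP _ (tH 0%N)) (tj 0%N).
have tF n : fam (branch (t n)) j = F.
  exact: (ga_pass g0 (HP _ (tH n)) (common_agree cH (tH n) (tH 0%N)) (tj n)).
have [|n|n|n|y [cy py]] := @pos_step_fan S F B (fun n => body (t n))
    (fun n => ord (branch (t n)) j).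
- move=> m n mn; apply: tinj; move: (tF m); rewrite -(tF n) /= => fE.
  by move: fE mn; rewrite /fam /ord; case: (branch (t m) j) (branch (t n) j) =>
    [u v] [u' v'] /= -> ->.
- by have [] := gpP (HP _ (tH n)) (tj n).
- by rewrite -(tF n); have [_ _ _] := prP (HP _ (tH n)); apply; exact: tj.
- exact: HB.
(* The path follows [t 0] up to level [j] and there turns to the child [y]. *)
pose x i := if pselect (i = j) is left _ then (F, y) else branch (t 0) i.
have xj : x j = (F, y) by rewrite /x; case: pselect.
have ax : agree (branch (t 0)) x j.
  by move=> i ij; rewrite /x; case: pselect => // E; move: ij; rewrite E => /(wo_irr wo).
have gx : good_at base P x j (fam x j).
  by rewrite /fam xj; exact: good_at_agree ax g0.
have cx : omega_cofinal (ord x j) by rewrite /ord xj.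
exists x, (ssucc j), (below x j); split.
- move=> i /ssucc_least/(wo_ltW wo)[->//|ij].
  have [co ga] := gpP (HP _ (tH 0%N)) (wo_trans wo ij (tj 0%N)).
  rewrite /ord /fam -ax //; split=> //; apply: good_at_agree ga => k ki.
  by apply: ax; exact: (wo_trans wo ki ij).
- exact: good_at_succ.
- by rewrite /below /fam /ord xj.
Qed.

(* Following one infinite class after another and shedding an element at each
   splitting level produces a comb, whose spine need not be the branch of an
   element of [P]. *)
Lemma comb_anchored (H : nat -> set (elt S)) (j : nat -> S) (t : nat -> elt S) :
  (forall n, H n `<=` P) -> (forall n, H n !=set0) ->
  (forall n, infinite_set (body (t n) `&` B)) ->
  (forall n, splits (H n) (j n)) -> (forall n, H n.+1 `<=` H n) ->
  (forall n, H n (t n)) ->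
  (forall n, exists2 v, H n.+1 `<=` passes v (j n) & ~ passes v (j n) (t n)) ->
  anchored.
Proof.
move=> HP H0 tB jH Hmono tH Hv.
have Hle m n : (m <= n)%N -> H n `<=` H m.
  elim: n => [|n IH]; first by rewrite leqn0 => /eqP ->.
  rewrite leq_eqVlt => /predU1P[->//|mn]; exact: subset_trans (Hmono n) (IH mn).
have comS n i : ~ lt (j n) i -> common (H n.+1) i.
  move=> /(wo_ltW wo)[->|ij]; first by have [v Hn _] := Hv n; exists v.
  by apply: common_sub (Hmono n) _; have [_] := jH n; apply.
have jS n : lt (j n) (j n.+1).
  apply: contrapT => /(wo_ltW wo) jj.
  have [+ _] := jH n.+1; apply; apply: comS.
  exact: (wo_leN wo jj).
pose l := lsup j.
(* The spine consists of the common values of the sets [H n], which are consistent because these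
   sets are nested and nonempty; other levels get a dummy value. *)
have /choice[x xP'] : forall i, exists v, forall n, common (H n) i ->
    H n `<=` passes v i.
  move=> i; have [[n [v nv]]|N] := pselect (exists n, common (H n) i); last first.
    by exists (branch (t 0) i) => n cn; exfalso; apply: N; exists n.
  exists v => m [w mw]; have [d Hd] := H0 (maxn n m).
  have [_ dv] := nv _ (Hle _ _ (leq_maxl n m) _ Hd).
  have [_ dw] := mw _ (Hle _ _ (leq_maxr n m) _ Hd).
  by rewrite -dv dw.
have xP n i e : common (H n) i -> H n e -> lt i (len e) /\ branch e i = x i.
  by move=> cn; exact: xP'.
have xagree n e : H n e -> agree (branch e) x (j n).
  by move=> Hne i ij; have [_ cn] := jH n; have [] := xP n i e (cn i ij) Hne.
have jl n : lt (j n) l by exact: lsup_ub.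
have lj i : lt i l -> exists n, ~ lt (j n) i by exact: lsup_least.
have good i : lt i l -> omega_cofinal (ord x i) /\ good_at base P x i (fam x i).
  move=> /lj[n ni]; have [e He] := H0 n.+1.
  have [ie pe] := xP _ _ _ (comS _ _ ni) He.
  have [co ga] := gpP (HP _ _ He) ie.
  rewrite /ord /fam -pe; split=> //; apply: good_at_agree ga.
  apply: agree_le (xagree _ _ He) _.
  exact: (wo_le_trans wo ni (wo_leN wo (or_intror (jS n)))).
have xfollows n i e : ~ lt (j n) i -> H n.+1 e -> follows (body e) (below x i).
  move=> ni He; have [ie pe] := xP _ _ _ (comS _ _ ni) He.
  have [_ _ _ fo] := prP (HP _ _ He).
  by have := fo _ ie; rewrite /below /fam /ord pe.
(* If an element of [P] passes through the limit node, the family there is forced. Otherwise [F0]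
   collects what the node inherits and the body of the at most one element ending there. *)
pose F0 := base `|` (\bigcup_n below x (j n) `|`
  @body S @` [set e | P e /\ len e = l /\ agree (branch e) x l]).
have [F gF] : exists F, good_at base P x l F.
  have [[e [Pe [le ae]]]|N] :=
    pselect (exists e, P e /\ (lt l (len e) /\ agree (branch e) x l)).
    by exists (fam (branch e) l); have [_ ga] := gpP Pe le; exact: good_at_agree ga.
  exists F0; split.
  - apply: countable_setUI; last apply: countable_setUI.
    + have [_ g0] := good _ (jl 0%N).
      exact: sub_countable (subset_card_le (ga_base g0)) (ga_countable g0).
    + apply: bigcup_countable => // n _; have [_ ga] := good _ (jl n).
      exact: step_countable (ga_countable ga).
    + apply/finite_set_countable/finite_image.
      set E := [set e | _]; have [[z Ez]|nz] := pselect (E !=set0); last first.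
        by apply: sub_finite_set (finite_set0 _) => e Ee; apply: nz; exists e.
      apply: sub_finite_set (finite_set1 z) => e [Pe [le ae]].
      have [Pz [lz az]] := Ez.
      apply: uniqP => //; first by rewrite lz.
      by rewrite le; exact: agree_trans ae (agreeC az).
  - by move=> W bW; left.
  - move=> i /lj[n ni] W Wi; right; left; exists n => //.
    have [iE|ij] := wo_ltW wo ni; first by rewrite -iE.
    by left; have [_ ga] := good _ (jl n); exact: ga_below ga _ ij _ Wi.
  - move=> i li; exfalso; have /lj[n ni] : lt i l by rewrite li; exact: ssucc_gt.
    have := jl n.+1; rewrite li => /ssucc_least; apply.
    exact: (wo_le_lt wo ni (jS n)).
  - move=> W [bW|[[n _ Wn]|[e [Pe [le ae]] <-]]]; first exact: Or31.
      by apply: Or32; exists (j n).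
    by apply: Or33; exists e.
  - by move=> e Pe ae le; exfalso; apply: N; exists e.
  - by move=> e Pe ae le; right; right; exists e.
exists x, l, F; split=> //.
(* An inherited member is almost missed by all teeth shed after its level, and the body of an
   element ending at the limit node by every tooth. Each tooth is almost covered by a member of the
   spine's child at its own level. *)
apply: (@pos_of_teeth _ _ (fun n => body (t n)) tB) =>
  [Z /(ga_exact gF)[bZ|[i il Zi]|[e Pe [le ae <-]]]|n].
- by exists 0%N => n _; exact: body_follows_base cohP _ (HP _ _ (tH n)) _ bZ.
- have [N Ni] := lj _ il; exists N.+1 => n Nn.
  exact: xfollows Ni (Hle _ _ Nn _ (tH n)) _ Zi.
- exists 0%N => n _; apply: coherent_ad cohP _ _ (HP _ _ (tH n)) Pe _ => tE.
  have [v Hn] := Hv n; apply; rewrite tE; split; first by rewrite le.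
  have [d Hd] := H0 n.+1; have [_ dv] := Hn _ Hd.
  by rewrite ae // -dv; have [] := xP _ _ _ (comS n (j n) (wo_irr wo (x:=_))) Hd.
- have [co ga] := good _ (jl n).
  have [||W sW aW] := body_covered cohP (HP _ _ (tH n)) co ga (xagree _ _ (tH n)).
  + by have [_ cn] := jH n; exact: common_len cn (tH n).
  + move=> jt pt; have [v Hn] := Hv n; apply; split=> //.
    have [d Hd] := H0 n.+1; have [_ dv] := Hn _ Hd.
    by rewrite pt -dv; have [] := xP _ _ _ (comS n (j n) (wo_irr wo (x:=_))) Hd.
  + by exists W => //; exact: ga_below gF _ (jl n) _ sW.
Qed.

(** If some splitting has only finite classes, there is a fan. Otherwise an infinite class can be
    kept each time and an element outside it shed, which gives a comb. *)
Lemma infinite_anchored (H0 : set (elt S)) : H0 `<=` P -> infinite_set H0 ->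
  (forall e, H0 e -> infinite_set (body e `&` B)) -> anchored.
Proof.
move=> HP infH HB; apply: contrapT => NA.
have step H : exists r : set (elt S) * S * elt S, H `<=` H0 -> infinite_set H ->
    [/\ splits H r.1.2, r.1.1 `<=` H, infinite_set r.1.1, H r.2 &
      exists2 v, r.1.1 `<=` passes v r.1.2 & ~ passes v r.1.2 r.2].
  have [e0 _] := infinite_setN0 infH.
  have [[HH0 iH]|N] := pselect (H `<=` H0 /\ infinite_set H); last first.
    by exists (set0, len e0, e0) => HH0 iH; exfalso; exact: N.
  have [j jH] := splits_exists (infinite_setN0 iH).
  have [v infv] : exists v, infinite_set (H `&` passes v j).
    apply: contrapT => N; apply: NA; apply: (@fan_anchored H j) => //.
    - exact: subset_trans HP.
    - by move=> e /HH0; exact: HB.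
    - by move=> v; apply: contrapT => infv; apply: N; exists v.
  have [t Ht nt] : exists2 t, H t & ~ passes v j t.
    apply: contrapT => N; case: jH => + _; apply; exists v => e He.
    by apply: contrapT => ne; apply: N; exists e.
  by exists (H `&` passes v j, j, t) => _ _; split=> //;
    [move=> e []|exists v => // e []].
have {step} /choice[r rP] := step.
pose H n := iter n (fun H => (r H).1.1) H0.
have Hinv n : H n `<=` H0 /\ infinite_set (H n).
  elim: n => [|n [sub inf]]; first by split.
  have [_ sub' inf' _ _] := rP _ sub inf.
  by split=> //; exact: subset_trans sub' sub.
have HrP n := rP _ (Hinv n).1 (Hinv n).2.
apply: NA; apply: (@comb_anchored H (fun n => (r (H n)).1.2) (fun n => (r (H n)).2)).
- by move=> n; exact: subset_trans (Hinv n).1 HP.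
- by move=> n; exact: infinite_setN0 (Hinv n).2.
- by move=> n; apply: HB; apply: (Hinv n).1; have [] := HrP n.
- by move=> n; have [] := HrP n.
- by move=> n; have [] := HrP n.
- by move=> n; have [] := HrP n.
- by move=> n; have [] := HrP n.
Qed.

End Split.

(** * An almost disjoint family of true cardinality continuum *)

(** Triples [(k, (r, m))] are coded injectively: the first coordinate gives the columns at the root,
    the second the sets W0, W1, W2, each meeting every column in an infinite set. *)
Definition column (k : nat) : set nat :=
  [set p | exists q : nat * nat, p = pickle (k, q)].

Definition piece (r : nat) : set nat :=
  [set p | exists k m : nat, p = pickle (k, (r, m))].

Definition columns : set (set nat) := range column.

Lemma columns_countable : countable columns.
Proof. exact: (card_le_trans (card_image_le _ _)). Qed.

Lemma piece_disjoint r s p : piece r p -> piece s p -> r = s.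
Proof.
by move=> [k [m ->]] [k' [m' /(pcan_inj pickleK)[_ -> _]]].
Qed.

Lemma pos_piece r : pos columns (piece r).
Proof.
move=> D finD DC; have [k nDk] : exists k, ~ D (column k).
  apply: contrapT => N.
  suff : infinite_set D by exact.
  apply: (@sub_infinite_set _ columns).
  - by move=> _ [k _ <-]; apply: contrapT => nDk; apply: N; exists k.
  - apply/infiniteP/card_le_setTP; exists column; last by move=> k; exists k.
    move=> k k'; rewrite predeqE => /(_ (pickle (k, (0%N, 0%N)))) [+ _].
    by case=> [|q /(pcan_inj pickleK)[]//]; exists (0%N, 0%N).
exists (column k); first by exists k.
have infk : infinite_set (range (fun m : nat => pickle (k, (r, m)))).
  apply/infiniteP/card_le_setTP; exists (fun m : nat => pickle (k, (r, m))) => [|m].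
    by move=> m m' /(pcan_inj pickleK)[].
  by exists m.
apply: sub_infinite_set infk => _ [m _ <-]; split.
  by split; [exists k, m|exists (r, m)].
move=> [Z DZ]; have [k' _ kZ] := DC _ DZ; rewrite -kZ => -[q].
by move=> /(pcan_inj pickleK)[kk' _]; apply: nDk; rewrite kk' kZ.
Qed.

(** The even half of a stage names the set to be treated; the free odd half makes every set recur at
    continuum many stages. *)
Definition stage_set (X : set nat) : set nat := [set n | X n.*2].

Lemma stage_set_fiber (B : set nat) : continuum_le [set X | stage_set X = B].
Proof.
apply/continuum_leP.
exists (fun Y => [set p | if odd p then Y p./2 else B p./2]).
  move=> Y Z YZ; rewrite predeqE => n.
  have := congr1 (fun T : set nat => T n.*2.+1) YZ.
  by rewrite /= odd_double /= uphalf_double => ->.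
move=> Y /=; rewrite predeqE => n.
by rewrite /stage_set /= odd_double doubleK.
Qed.

(** * The transfinite construction of the tree *)

Section Stages.
Variables (S : scale) (lt : set nat -> set nat -> Prop).
Hypotheses (wo : is_worder lt)
  (small : forall X, ~ continuum_le [set Y | lt Y X]).

Definition new_at (Q : set (elt S)) (X : set nat) (e : elt S) :=
  [/\ extends columns Q e, body e `<=` stage_set X &
      exists2 r, (r < 3)%N & body e `<=` piece r].

Lemma stages_exist : exists h : set nat -> option (elt S), forall X,
  let Q := [set e | exists2 Y, lt Y X & h Y = Some e] in
  (forall e, h X = Some e -> new_at Q X e) /\
  ((exists e, new_at Q X e) -> exists e, h X = Some e).
Proof.
have wf : well_founded lt by case: wo.
pose G X (r : forall Y, lt Y X -> option (elt S)) :=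
  if pselect (exists e, new_at [set e | exists Y YX, r Y YX = Some e] X e)
  is left H then Some (projT1 (cid H)) else None.
have GE X : Fix wf (fun=> option (elt S)) G X =
    G X (fun Y _ => Fix wf (fun=> option (elt S)) G Y).
  rewrite Fix_eq // => Z r r' rr'; have -> // : r = r'.
  apply: functional_extensionality_dep => Y.
  by apply: functional_extensionality_dep => YZ; exact: rr'.
set h := Fix wf (fun=> option (elt S)) G in GE.
exists h => X Q.
have QE : [set e | exists Y (_ : lt Y X), h Y = Some e] = Q.
  rewrite predeqE => e; split=> [[Y [YX hY]]|[Y YX hY]]; first by exists Y.
  by exists Y, YX.
rewrite GE /G QE; case: pselect => [H|nH]; last by split.
split; first by move=> _ [<-]; exact: (projT2 (cid H)).
by move=> _; eexists.
Qed.

Let h := projT1 (cid stages_exist).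
Let hP := projT2 (cid stages_exist).

Definition before (X : set nat) := [set e | exists2 Y, lt Y X & h Y = Some e].

Definition tree := [set e | exists2 X, True & h X = Some e].

Lemma coherent_before X : coherent columns (before X).
Proof.
apply: (coherent_range (D := [set Y | lt Y X]) wo).
- by move=> Y Z YZ ZX; exact: (wo_trans wo YZ ZX).
- by move=> Y e hY; have [/(_ e hY)[]] := hP Y.
Qed.

Lemma coherent_tree : coherent columns tree.
Proof.
apply: (coherent_range (D := [set: set nat]) wo) => // Y e hY.
by have [/(_ e hY)[]] := hP Y.
Qed.

Lemma before_small X : ~ continuum_le (before X).
Proof.
move=> /continuum_leP[f finj fX]; apply: (small (X := X)).
apply: (@continuum_le_image _ _ h); apply/continuum_leP.
exists (Some \o f) => [Y Z [/finj]//|Y].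
by have [Z ZX hZ] := fX Y; exists Z.
Qed.

Lemma stage_anchored X r : (r < 3)%N ->
  anchored columns (before X) (stage_set X `&` piece r) ->
  exists2 e, h X = Some e & body e `<=` stage_set X.
Proof.
move=> r3 [x [l [F [gx gF pF]]]].
have [e ee eB] := extend (coherent_before X) gx gF pF (@before_small X).
have [h1 h2] := hP X.
have [|f hf] := h2.
  exists e; split=> //; first by move=> p /eB[].
  by exists r => // p /eB[].
by exists f => //; have [] := h1 f hf.
Qed.

Definition bodies := @body S @` tree.

Lemma tree_infinite e : tree e -> infinite_set (body e).
Proof. by move=> te; have [_ /(_ e te)[]] := coherent_tree. Qed.

Lemma tree_body_inj e e' : tree e -> tree e' -> body e = body e' -> e = e'.
Proof.
move=> te te' ee'; apply: contrapT => ne.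
have := coherent_ad coherent_tree te te' ne; rewrite -ee' /ad setIid.
exact: tree_infinite.
Qed.

(** An element cannot be added twice: freeness of its end would make its length smaller than
    itself. *)
Lemma stage_inj X Y e : h X = Some e -> h Y = Some e -> X = Y.
Proof.
have aux Z Z' : h Z = Some e -> h Z' = Some e -> ~ lt Z Z'.
  move=> hZ hZ' ZZ'; have [/(_ e hZ')[[_ _ ne] _ _] _] := hP Z'.
  have : slt (len e) (len e) by apply: ne => //; exists Z.
  exact: (wo_irr (slt_wo S)).
by move=> hX hY; case: (wo_total wo X Y) => // /aux;
  [move=> /(_ hX hY)|move=> /(_ hY hX)].
Qed.

Lemma bodies_continuum (B : set nat) r (Q : set (set nat)) : (r < 3)%N ->
  continuum_le Q -> (forall X, Q X -> stage_set X = B /\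
    anchored columns (before X) (B `&` piece r)) ->
  continuum_le (ad_restr bodies B).
Proof.
move=> r3 /continuum_leP[f finj fQ] QP; apply/continuum_leP.
have /choice[g gP] : forall Y, exists e, h (f Y) = Some e /\ body e `<=` B.
  move=> Y; have [fE af] := QP _ (fQ Y).
  have [|e he eB] := @stage_anchored (f Y) r r3; first by rewrite fE.
  by exists e; rewrite fE in eB.
have tg Y : tree (g Y) by exists (f Y) => //; exact: (gP Y).1.
exists (fun Y => body (g Y)) => [Y Z|Y].
  move=> /(tree_body_inj (tg Y) (tg Z)) gYZ; apply: finj.
  by apply: stage_inj (gP Y).1 _; rewrite gYZ; exact: (gP Z).1.
split; first by exists (g Y).
have gB := (gP Y).2; rewrite (setIidl gB); exact: tree_infinite.
Qed.

Lemma bodies_piece r : (r < 3)%N -> continuum_le (ad_restr bodies (piece r)).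
Proof.
move=> r3; apply: (bodies_continuum r3 (stage_set_fiber (piece r))) => X XE.
split=> //; apply: good_root; first exact: coherent_before.
- exact: columns_countable.
- by rewrite setIid; exact: pos_piece.
Qed.

(** Infinitely many of the elements meeting [B] lie in one piece. A sequence of them is complete
    before continuum many of the stages devoted to [B], since countably many small initial segments
    do not exhaust these stages. At each of the remaining ones [B] is anchored and a new element
    inside [B] appears. *)
Lemma bodies_true (B : set nat) :
  finite_set (ad_restr bodies B) \/ continuum_le (ad_restr bodies B).
Proof.
have [|inf] := pselect (finite_set (ad_restr bodies B)); [by left|right].
pose H r := [set e | [/\ tree e, infinite_set (body e `&` B) & body e `<=` piece r]].
have [r r3 infH] : exists2 r, (r < 3)%N & infinite_set (H r).
  apply: contrapT => N; apply: inf.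
  have finH : finite_set (\bigcup_(r in `I_3) H r).
    apply: bigcup_finite; first exact: finite_II.
    by move=> r r3; apply: contrapT => infr; apply: N; exists r.
  apply: sub_finite_set (finite_image (@body S) finH).
  move=> _ [[e te <-] ieB]; exists e => //.
  have [X _ hX] := te; have [/(_ e hX)[_ _ [r r3 er]] _] := hP X.
  by exists r.
have /infiniteP/card_le_setTP[t tinj tH] := infH.
have /choice[Xt XtP] : forall n, exists X, h X = Some (t n).
  by move=> n; have [[X _ hX]] := tH n; exists X.
pose Q := [set X | stage_set X = B /\ forall n, lt (Xt n) X].
have cQ : continuum_le Q.
  have [|[|n]] := @continuum_bigcup _
    (fun n => if n is n'.+1 then [set X | ~ lt (Xt n') X] else Q).
  - apply: continuum_le_sub (stage_set_fiber B) => X XB.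
    have [late|/existsNP[n nX]] := pselect (forall n, lt (Xt n) X).
      by exists 0%N.
    by exists n.+1.
  - by [].
  - move=> cn; exfalso.
    have [|/small//|/continuum_infinite] :=
      @continuum_setU _ [set Y | lt Y (Xt n)] [set Xt n].
      by apply: continuum_le_sub cn => X /(wo_ltW wo)[->|]; [right|left].
    by apply; exact: finite_set1.
apply: (bodies_continuum r3 cQ) => X [XB late]; split=> //.
apply: (@infinite_anchored _ _ _ (coherent_before X) _ (range t)).
- by move=> _ [n _ <-]; exists (Xt n).
- by apply/infiniteP/card_le_setTP; exists t => // n; exists n.
- move=> _ [n _ <-]; have [_ itB tr] := tH n.
  by rewrite setIA setIAC (setIidl tr).
Qed.

End Stages.

Lemma true_cardinality_exists : exists A : set (set nat), [/\
  forall a, A a -> infinite_set a /\ exists2 r, (r < 3)%N & a `<=` piece r,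
  forall a b, A a -> A b -> a <> b -> ad a b,
  forall B, finite_set (ad_restr A B) \/ continuum_le (ad_restr A B) &
  forall r, (r < 3)%N -> continuum_le (ad_restr A (piece r))].
Proof.
have [S _] := scale_exists.
have [lt [wo small]] := continuum_worder.
exists (bodies S wo); split.
- move=> _ [e te <-]; split; first exact: (tree_infinite te).
  have [X _ hX] := te.
  by have [/(_ e hX)[]] := projT2 (cid (stages_exist S wo)) X.
- move=> _ _ [e te <-] [e' te' <-] ne.
  by apply: (coherent_ad (coherent_tree S wo) te te') => ee'; apply: ne; rewrite ee'.
- exact: bodies_true.
- exact: bodies_piece.
Qed.

(** * Merging elements in pairs *)

(** The choice runs along a well-order with small initial segments, so the values used before never
    exhaust [F i]. *)
Lemma distinct_representatives (T : Type) (F : set nat -> set T) :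
  (forall i, continuum_le (F i)) ->
  exists2 f : set nat -> T, injective f & forall i, F i (f i).
Proof.
move=> cF; have [lt [wo small]] := continuum_worder.
have [t0 _] := infinite_setN0 (continuum_infinite (cF set0)).
have wf : well_founded lt by case: wo.
pose G i (r : forall j, lt j i -> T) :=
  if pselect (exists t, F i t /\ forall j ji, r j ji <> t) is left H
  then projT1 (cid H) else t0.
pose f := Fix wf (fun=> T) G.
have fE i : f i = G i (fun j _ => f j).
  rewrite /f Fix_eq // => k r r' rr'; have -> // : r = r'.
  apply: functional_extensionality_dep => j.
  by apply: functional_extensionality_dep => jk; exact: rr'.
have fP i : F i (f i) /\ forall j, lt j i -> f j <> f i.
  have H : exists t, F i t /\ forall j (ji : lt j i), f j <> t.
    apply: contrapT => N; apply: (small i); apply: (@continuum_le_image _ _ f).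
    apply: continuum_le_sub (cF i) => t Ft; apply: contrapT => nt.
    by apply: N; exists t; split=> // j ji ft; apply: nt; exists j.
  rewrite [f i]fE /G; case: pselect => // H'; exact: (projT2 (cid H')).
exists f; last by move=> i; exact: (fP i).1.
move=> i j fij; case: (wo_total wo i j) => // [ij|ji].
  by have [_ /(_ i ij)] := fP j.
by have [_ /(_ j ji)] := fP i; rewrite fij.
Qed.

Definition odd_set (X : set nat) : set nat := [set n | X n.*2.+1].

Lemma stage_odd_exists (P Q : set nat) : exists X, stage_set X = P /\ odd_set X = Q.
Proof.
exists [set p | if odd p then Q p./2 else P p./2].
split; rewrite predeqE => n; rewrite /stage_set /odd_set /=.
  by rewrite odd_double doubleK.
by rewrite odd_double /= uphalf_double.
Qed.

Lemma finite_inj_preimage (T U : Type) (f : T -> U) (A : set U) :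
  injective f -> finite_set A -> finite_set (f @^-1` A).
Proof.
move=> finj finA; have : finite_set (f @` (f @^-1` A)).
  by apply: sub_finite_set finA => _ [t At <-].
by rewrite (eq_finite_set (inj_card_eq _)) // => x y _ _; exact: finj.
Qed.

Section Merge.
Variable A : set (set nat).
Hypotheses (Ainf : forall a, A a -> infinite_set a)
  (Aad : forall a b, A a -> A b -> a <> b -> ad a b)
  (AT : continuum_le A).

Definition big (B : set nat) := continuum_le (ad_restr A B).

Lemma merge_exists : exists F : set (set nat), [/\
  forall c, F c -> exists a b, [/\ A a, A b & c = a `|` b],
  forall c d, F c -> F d -> c <> d -> ad c d,
  forall P Q, big P -> big Q -> exists a b, [/\ F (a `|` b), A a, A b,
    infinite_set (a `&` P) & infinite_set (b `&` Q)],
  forall B, finite_set (ad_restr A B) -> finite_set (ad_restr F B) &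
  forall B, big B -> continuum_le (ad_restr F B)].
Proof.
(* The even half of [i] codes the pair of sets; the free odd half lets each pair be treated
   continuum many times. *)
pose L (i : set nat) := stage_set (stage_set i).
pose R (i : set nat) := odd_set (stage_set i).
pose bigs i := big (L i) /\ big (R i).
(* At a code of [(i, b)] this is the set from which one half of the union for [i] is chosen; [A] is
   a default for indices that code no pair of big sets. *)
pose E (k : set nat) : set (set nat) := if pselect (bigs (stage_set k))
  then ad_restr A (if pselect (odd_set k 0%N) then L (stage_set k) else R (stage_set k))
  else A.
have cE k : continuum_le (E k).
  rewrite /E; case: (pselect (bigs (stage_set k))) => [[bL bR]|//] /=.
  by case: (pselect (odd_set k 0%N)).
have [f finj fE] := distinct_representatives cE.
have /choice[code codeP] : forall ib : set nat * bool, exists k,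
    stage_set k = ib.1 /\ odd_set k = [set _ | ib.2].
  by move=> ib; exact: stage_odd_exists.
have codeI : injective code.
  move=> [i b] [j c] ij; have [/= iE bE] := codeP (i, b).
  have [/= jE cE'] := codeP (j, c); congr (_, _); first by rewrite -iE -jE ij.
  have : [set _ : nat | b] 0%N = [set _ : nat | c] 0%N by rewrite -bE -cE' ij.
  by move=> /= bc; apply/idP/idP; rewrite bc.
pose u i b := f (code (i, b)).
have uI i b j c : u i b = u j c -> (i, b) = (j, c) by move=> /finj/codeI.
have uE i b : bigs i -> ad_restr A (if b then L i else R i) (u i b).
  move=> bi; have := fE (code (i, b)); rewrite /E; have [-> ->] := codeP (i, b).
  case: (pselect (bigs (i, b).1)) => [_|//] /=.
  by case: (pselect b) => /= bT; case: b bT.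
have uA i b : bigs i -> A (u i b) by move=> /(uE i b)[].
pose m i := u i true `|` u i false.
have uad i b j c : bigs i -> bigs j -> (i, b) <> (j, c) -> ad (u i b) (u j c).
  by move=> bi bj ne; apply: Aad; [exact: uA|exact: uA|move=> /uI].
have mad i j : bigs i -> bigs j -> i <> j -> ad (m i) (m j).
  move=> bi bj ne; rewrite /ad /m setIUl !setIUr.
  by apply: finite_setUI; apply: finite_setUI; apply: uad => // /(congr1 fst)/ne.
exists (m @` bigs); split.
- by move=> _ [i bi <-]; exists (u i true), (u i false); split=> //; exact: uA.
- by move=> _ _ [i bi <-] [j bj <-] ne; apply: mad => // ij; apply: ne; rewrite ij.
- move=> P Q bP bQ; have [j [jP jQ]] := stage_odd_exists P Q.
  have [i [ij _]] := stage_odd_exists j set0.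
  have Li : L i = P by rewrite /L ij.
  have Ri : R i = Q by rewrite /R ij.
  have bi : bigs i by rewrite /bigs Li Ri.
  exists (u i true), (u i false); have := uE i true bi; have := uE i false bi.
  by rewrite Li Ri => -[? ?] [? ?]; split=> //; exists i.
(* Different indices use different elements of [A], so only finitely many unions have a half meeting
   [B] in an infinite set. *)
- move=> B finB; pose I b := (u^~ b) @^-1` ad_restr A B.
  have finI b : finite_set (I b).
    by apply: finite_inj_preimage finB => i j /uI[].
  apply: sub_finite_set (finite_image m (finite_setUI (finI true) (finI false))).
  move=> _ [[i bi <-] inf]; exists i => //.
  have [infT|finT] := pselect (infinite_set (u i true `&` B)).
    by left; split=> //; exact: uA.
  right; split; first exact: uA.
  move=> finF; apply: inf; rewrite /m setIUl; apply: finite_setUI => //.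
  exact: contrapT finT.
- move=> B bB; have [j [jL jR]] := stage_odd_exists B B.
  have [g ginj gj] := (continuum_leP _).1 (stage_set_fiber j).
  have bg X : bigs (g X) by rewrite /bigs /L /R gj jL jR.
  apply/continuum_leP; exists (m \o g) => [X Y /= mXY|X].
    apply: ginj; apply: contrapT => ne; have := mad _ _ (bg X) (bg Y) ne.
    rewrite -mXY /ad setIid; apply: sub_infinite_set (Ainf (uA _ true (bg X))).
    by move=> p; left.
  split; first by exists (g X).
  have [_] := uE (g X) true (bg X); rewrite /L gj jL.
  by apply: sub_infinite_set => p [up Bp]; split=> //; left.
Qed.

End Merge.

(** * The space Psi *)

Section PsiSpace.
Variable F : set (set nat).
Hypotheses (Finf : forall c, F c -> infinite_set c)
  (Fad : forall c d, F c -> F d -> c <> d -> ad c d).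
Implicit Types (U V P Q : set (Psi F)) (a b : F).

Definition trace U : set nat := [set n | U (Psi_nat F n)].

Lemma ptP a : F (set_val a). Proof. exact: set_valP. Qed.

Lemma nbhs_natP n U : nbhs (Psi_nat F n) U <-> U (Psi_nat F n).
Proof.
split=> [[V /= -> VU]|Un]; first exact: VU.
by exists [set Psi_nat F n] => //= x ->.
Qed.

Lemma nbhs_ptP a U : nbhs (Psi_pt a) U <->
  U (Psi_pt a) /\ asub (set_val a) (trace U).
Proof.
split=> [[V /= [G finG <-] VU]|[Ua finU]].
  split; first by apply: VU; left.
  apply: sub_finite_set finG => n [an nU]; apply: contrapT => nG; apply: nU.
  by apply: VU; right; exists n.
exists (Psi_pt a |` Psi_nat F @` (set_val a `\` (set_val a `\` trace U))).
  by exists (set_val a `\` trace U).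
move=> x [/= xE|[n [an nn] <-]]; first by rewrite xE.
by apply: contrapT => nU; apply: nn.
Qed.

Lemma open_PsiP U : open U <->
  forall a, U (Psi_pt a) -> asub (set_val a) (trace U).
Proof.
rewrite openE; split=> [oU a /oU /nbhs_ptP[]//|H].
move=> [n|a] Ux; first by apply/(nbhs_natP n).
by apply/(nbhs_ptP a); split=> //; exact: H.
Qed.

Lemma closure_natP n U : closure U (Psi_nat F n) <-> U (Psi_nat F n).
Proof.
split=> [clU|]; last exact: subset_closure.
have [|x [Ux /= xE]] := clU [set Psi_nat F n]; last by rewrite -xE.
exact/nbhs_natP.
Qed.

Lemma closure_ptP a U : closure U (Psi_pt a) <->
  U (Psi_pt a) \/ infinite_set (set_val a `&` trace U).
Proof.
split=> [clU|[|infU]]; last 2 first.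
- exact: subset_closure.
- move=> V /nbhs_ptP[_ finV].
  have [n [[an Un] nV]] := infinite_setN0 (infinite_setD infU finV).
  exists (Psi_nat F n); split=> //; apply: contrapT => nVn; exact: nV.
have [Ua|nUa] := pselect (U (Psi_pt a)); [by left|right] => finU.
have [|x [Ux nUx]] := clU (~` U); last exact: nUx.
apply/nbhs_ptP; split=> //; apply: sub_finite_set finU => n [an nn]; split=> //.
exact: contrapT nn.
Qed.

(** Numbers are isolated, so the interior of [P] has the same trace as [P]; a point of the interior
    has almost all its numbers in that trace. *)
Lemma regclosed_ptP P a : regclosed P ->
  P (Psi_pt a) <-> infinite_set (set_val a `&` trace P).
Proof.
move=> rP; have trE : trace P° = trace P.
  rewrite /trace predeqE => n /=; split=> [/interior_subset//|Pn].
  exact/nbhs_natP.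
rewrite -{1}rP closure_ptP trE; split=> [[/nbhs_ptP[_ finP]|//]|]; last by right.
apply: sub_infinite_set (infinite_setD (Finf (ptP a)) finP) => n [an nn].
by split=> //; apply: contrapT => nP; exact: nn.
Qed.

(** Basic neighbourhoods are closed: by almost disjointness no further point of [F] lies in their
    closure. *)
Lemma Psi_regular : regular_space (Psi F).
Proof.
move=> x U [V xV VU]; exists V; first by exists V.
apply: subset_trans VU; case: x xV => [n /= ->|a [G finG <-]].
  move=> [m /closure_natP//|b /closure_ptP[//|]]; case.
  by apply: sub_finite_set (finite_set1 n) => m [_ [->]].
set W := _ `|` _; have trW : trace W `<=` set_val a.
  by move=> n [//|[m [am _] [<-]]].
move=> [m /closure_natP//|b /closure_ptP[//|infb]].
have [ab|ne] := pselect (set_val b = set_val a).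
  by left; rewrite (val_inj ab).
exfalso; apply: infb; apply: sub_finite_set (Fad (ptP b) (ptP a) ne).
by move=> n [bn /trW].
Qed.

Lemma open_separatedC (X : topologicalType) (P Q : set X) :
  open_separated P Q -> open_separated Q P.
Proof.
by move=> [U [V [oU oV PU QV UV]]]; exists V, U; split=> //; rewrite setIC.
Qed.

(** The set [U] is clopen: it takes in the finitely many elements of [F] at points of [P] whole,
    except for the trace of [Q], which meets each of them in a finite set only. *)
Lemma finite_separated P Q : regclosed P -> regclosed Q -> P `&` Q = set0 ->
  finite_set (ad_restr F (trace P)) -> open_separated P Q.
Proof.
move=> rP rQ PQ finP.
have PQN x : P x -> Q x -> False by move=> Px Qx; rewrite -[False]/(set0 x) -PQ.
pose X := (trace P `|` \bigcup_(c in ad_restr F (trace P)) c) `\` trace Q.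
pose U : set (Psi F) := fun y => match y with
  | inl n => X n | inr a => infinite_set (set_val a `&` trace P) end.
have trU : trace U = X by [].
exists U, (~` U); split.
- apply/open_PsiP => a infa; rewrite trU.
  have finQ : finite_set (set_val a `&` trace Q).
    apply: contrapT => infQ; apply: (PQN (Psi_pt a)).
      exact/(regclosed_ptP a rP).
    exact/(regclosed_ptP a rQ).
  apply: sub_finite_set finQ => n [an nX]; split=> //; apply: contrapT => nQ.
  apply: nX; split=> //; right; exists (set_val a) => //; split=> //; exact: ptP.
- apply/open_PsiP => a /= /contrapT fina.
  have finb : finite_set (\bigcup_(c in ad_restr F (trace P)) (set_val a `&` c)).
    apply: bigcup_finite => // c [Fc infc]; apply: Fad => //; first exact: ptP.
    by move=> ac; apply: infc; rewrite -ac.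
  apply: sub_finite_set (finite_setUI fina finb) => n [an].
  have -> : trace (~` U) = ~` X by [].
  move=> /contrapT[[Pn|[c cP cn]] _]; first by left.
  by right; exists c.
- move=> [n Pn|a /(regclosed_ptP a rP)//]; split; first by left.
  by move=> Qn; exact: PQN Pn Qn.
- move=> [n Qn [_]|a Qa]; first exact.
  move=> /(regclosed_ptP a rP) Pa; exact: PQN Pa Qa.
- exact: setICr.
Qed.

Definition nat_closure (W : set nat) : set (Psi F) := closure (Psi_nat F @` W).

Lemma trace_image (W : set nat) : trace (Psi_nat F @` W) = W.
Proof.
by rewrite /trace predeqE => n; split=> [[m Wm [<-]]//|Wn]; exists n.
Qed.

Lemma nat_closure_regclosed W : regclosed (nat_closure W).
Proof.
by apply: closure_open_regclosed; apply/open_PsiP => a [].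
Qed.

Lemma nat_closure_natP W n : nat_closure W (Psi_nat F n) <-> W n.
Proof. by rewrite /nat_closure closure_natP -{2}(trace_image W). Qed.

Lemma nat_closure_ptP W a :
  nat_closure W (Psi_pt a) <-> infinite_set (set_val a `&` W).
Proof.
rewrite /nat_closure closure_ptP trace_image; split=> [[[]//|//]|]; by right.
Qed.

End PsiSpace.

(** * Mild normality and the failure of partial normality for the merged family *)

Theorem mainTheorem2 : exists F : set (set nat),
  almost_disjoint_family F /\
  true_cardinality_continuum F /\
  mildly_normal (Psi F) /\
  ~ partly_normal (Psi F).
Proof.
have [A [Amono Aad Atrue Apiece]] := true_cardinality_exists.
have Ainf a : A a -> infinite_set a by case/Amono.
have AT : continuum_le A.
  by apply: continuum_le_sub (Apiece 0%N isT) => a [].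
have [F [Fmerge Fad Fpair Ffin Fbig]] := merge_exists Ainf Aad AT.
have Finf c : F c -> infinite_set c.
  move=> /Fmerge[a [b [Aa _ ->]]]; apply: sub_infinite_set (Ainf a Aa).
  by move=> n; left.
have Fne c d : F c -> F d -> c <> d -> finite_set (c `&` d) by exact: Fad.
have big_or B : finite_set (ad_restr A B) \/ big A B by exact: Atrue.
exists F; split; [split|split; [|split; [split|move=> [_ HF]]]] => //.
- apply: (@sub_infinite_set _ (ad_restr F (piece 0))) => [c []//|].
  exact/continuum_infinite/Fbig/Apiece.
- move=> B; have [/Ffin|/Fbig bB] := big_or B; [by left|right].
  by apply: Cantor_Bernstein => //; exact: card_leT.
- exact: Psi_regular.
- move=> P Q rP rQ PQ.
  have [/Ffin finP|bP] := big_or (trace P); first exact: finite_separated.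
  have [/Ffin finQ|bQ] := big_or (trace Q).
    by apply: open_separatedC; apply: finite_separated => //; rewrite setIC.
  have [a [b [Fab _ _ aP bQ']]] := Fpair _ _ bP bQ; exfalso.
  pose c : F := exist _ (a `|` b) (mem_set Fab).
  have : set0 (Psi_pt c) by rewrite -PQ; split;
    [apply/(regclosed_ptP Finf c rP)|apply/(regclosed_ptP Finf c rQ)];
    [apply: sub_infinite_set aP|apply: sub_infinite_set bQ'] => n [abn Pn];
    split=> //; [left|right].
  exact.
pose Q0 := \bigcap_(C in [set nat_closure (piece 1); nat_closure (F := F) (piece 2)]) C.
have [|||U [V [oU oV PU QV UV]]] := HF (nat_closure (piece 0)) Q0.
- exact: nat_closure_regclosed.
- exists [set nat_closure (piece 1); nat_closure (F := F) (piece 2)].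
    exact: finite_set2.
  by split=> // C [->|->]; exact: nat_closure_regclosed.
(* A union of two elements of [A], each inside a single piece, cannot meet all three pieces in
   infinite sets. *)
- apply/seteqP; split=> // -[n|c] [x0 xQ]; have x1 := xQ _ (or_introl erefl);
    have x2 := xQ _ (or_intror erefl).
    move: x0 x1 => /nat_closure_natP x0 /nat_closure_natP x1.
    by have := piece_disjoint x0 x1.
  move: x0 x1 x2 => /nat_closure_ptP x0 /nat_closure_ptP x1 /nat_closure_ptP x2.
  have [a [b [Aa Ab cE]]] := Fmerge _ (ptP c).
  have [_ [ra _ ar]] := Amono _ Aa; have [_ [rb _ br]] := Amono _ Ab.
  have meets r : infinite_set (set_val c `&` piece r) -> r = ra \/ r = rb.
    move=> /infinite_setN0[n []]; rewrite cE => -[/ar an|/br bn] rn.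
      by left; exact: piece_disjoint rn an.
    by right; exact: piece_disjoint rn bn.
  by case: (meets _ x0) (meets _ x1) (meets _ x2) => <- [] // <- [].
- pose X := trace U.
  have UVN x : U x -> V x -> False by move=> Ux Vx; rewrite -[False]/(set0 x) -UV.
  have [finX|bX] := big_or (piece 1 `&` X); last first.
    (* The point given by [a] and [b] lies in both closures, hence in [V], although infinitely many
       of its numbers lie in [U]. *)
    have [a [b [Fab _ _ aX bW]]] := Fpair _ _ bX (Apiece 2%N isT).
    pose c : F := exist _ (a `|` b) (mem_set Fab).
    have Vc : V (Psi_pt c).
      apply: QV => C [->|->]; apply/nat_closure_ptP.
        by apply: sub_infinite_set aX => n [an [Wn _]]; split=> //; left.
      by apply: sub_infinite_set bW => n [bn Wn]; split=> //; right.
    have finV := (open_PsiP V).1 oV c Vc.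
    apply: aX; apply: sub_finite_set finV => n [an [_ Un]]; split; first by left.
    by move=> Vn; exact: UVN Un Vn.
  (* Since [piece 1] is big, its parts inside and outside [X] cannot both meet only finitely many
     elements of [A]. *)
  have [finX'|bX'] := big_or (piece 1 `\` X).
    apply: (continuum_infinite (Apiece 1%N isT)).
    apply: sub_finite_set (finite_setUI finX finX') => a [Aa infa].
    have [?|finaX] := pselect (infinite_set (a `&` (piece 1 `&` X))).
      by left.
    right; split=> // finaX'; apply: infa.
    apply: sub_finite_set (finite_setUI (contrapT finaX) finaX') => n [an Wn].
    by have [Xn|nXn] := pselect (X n); [left|right].
  (* This point lies in the closure of [piece 0], hence in [U], although infinitely many of its
     numbers lie outside [U]. *)
  have [a [b [Fab _ _ aW bX]]] := Fpair _ _ (Apiece 0%N isT) bX'.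
  pose c : F := exist _ (a `|` b) (mem_set Fab).
  have Uc : U (Psi_pt c).
    apply: PU; apply/nat_closure_ptP.
    by apply: sub_infinite_set aW => n [an Wn]; split=> //; left.
  have finU := (open_PsiP U).1 oU c Uc.
  by apply: bX; apply: sub_finite_set finU => n [bn [_ nXn]]; split=> //; right.
Qed.
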